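(* Let $M$ be a compact, orientable smooth manifold of dimension $m$ (possibly with boundary), let $m\le n$, and let $\mu$ be a fixed volume form on $M$. The geodesic distance $\operatorname{dist}^{\Omega^1_+}$ of the generalized Ebin metric $G$ on the manifold $\Omega^1_+(M,\mathbb R^n)$ of full-ranked $\mathbb R^n$-valued one-forms is non-degenerate (i.e. $\operatorname{dist}^{\Omega^1_+}(\alpha,\beta)>0$ whenever $\alpha\neq\beta$), and for all $\alpha,\beta\in\Omega^1_+(M,\mathbb R^n)$ it satisfies $$\operatorname{dist}^{\Omega^1_+}(\alpha,\beta)^2 \;\geq\; \int_M \operatorname{dist}^{n\times m}(\alpha(x),\beta(x))^2\,\mu .$$
   Context: $\Omega^1(M,\mathbb R^n)$ is the Fréchet space of smooth $\mathbb R^n$-valued one-forms on $M$; $\Omega^1_+(M,\mathbb R^n)$ is the open subset of those $\alpha$ for which $\alpha(x):T_xM\to\mathbb R^n$ is injective for all $x\in M$. The generalized Ebin metric on $\Omega^1_+(M,\mathbb R^n)$ is, for $\zeta,\eta\in T_\alpha\Omega^1_+(M,\mathbb R^n)=\Omega^1(M,\mathbb R^n)$, given in local coordinates (one-forms represented at $x$ by $n\times m$ matrices) by $$G_\alpha(\zeta,\eta)=\int_M \operatorname{tr}\big(\zeta_x(\alpha_x^T\alpha_x)^{-1}\eta_x^T\big)\sqrt{\det(\alpha_x^T\alpha_x)}\,dx .$$ The geodesic distance is the infimum of the lengths of (piecewise smooth) paths joining two points, where length is measured with the respective Riemannian metric (the infimum over the empty set being $+\infty$). $M_+(n,m)$ is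 the set of real $n\times m$ matrices of rank $m$, an open subset of the space $M(n,m)$ of all real $n\times m$ matrices, with the Riemannian metric $\langle u,v\rangle_a=\operatorname{tr}(u(a^Ta)^{-1}v^T)\sqrt{\det(a^Ta)}$; $\operatorname{dist}^{n\times m}$ is its geodesic distance. In $\operatorname{dist}^{n\times m}(\alpha(x),\beta(x))$, the linear maps $\alpha(x),\beta(x)$ are expressed as $n\times m$ matrices with respect to a basis of $T_xM$ having unit volume with respect to $\mu$ (the value does not depend on the choice of such a basis). *)

(* Defs.v *)
From HB Require Import structures.
From mathcomp Require Import all_boot all_order all_algebra.
From mathcomp Require Import all_classical all_reals all_analysis.

Set Implicit Arguments.
Unset Strict Implicit.
Unset Printing Implicit Defensive.

Import Order.TTheory GRing.Theory Num.Theory.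
Import numFieldNormedType.Exports.

Local Open Scope classical_set_scope.
Local Open Scope ring_scope.

(** * Lebesgue measure on R^m *)

(* The product sigma-algebra of R^m is available in the library on m-tuples. *)

Section measure_cons.
Context d (T : measurableType d) (R : realType) (m : nat).
Variable mu : {sigma_finite_measure set T -> \bar R}.
Variable nu : {sigma_finite_measure set (m.-tuple T) -> \bar R}.

Definition tuple_cons (p : T * m.-tuple T) : m.+1.-tuple T :=
  [tuple of p.1 :: p.2].

Lemma measurable_tuple_cons : measurable_fun [set: T * m.-tuple T] tuple_cons.
Proof. by apply: measurable_cons. Qed.

Definition measure_cons : set (m.+1.-tuple T) -> \bar R :=
  pushforward (mu \x nu)%E tuple_cons.

Let P : {measure set (m.+1.-tuple T) -> \bar R} :=
  measure_function_pushforward__canonical__measure_function_Measure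
    (mu \x nu)%E measurable_tuple_cons.

Let measure_cons0 : measure_cons set0 = 0%E.
Proof. exact: (measure0 P). Qed.

Let measure_cons_ge0 A : (0 <= measure_cons A)%E.
Proof. exact: (measure_ge0 P). Qed.

Let measure_cons_sigma_additive : semi_sigma_additive measure_cons.
Proof. exact: (@measure_semi_sigma_additive _ _ _ P). Qed.

HB.instance Definition _ := isMeasure.Build _ _ _ measure_cons
  measure_cons0 measure_cons_ge0 measure_cons_sigma_additive.

Let measure_cons_sigma_finite : sigma_finite setT measure_cons.
Proof.
have /sigma_finiteP[F [TF ndF Foo]] := sigma_finiteT mu.
have /sigma_finiteP[G [TG ndG Goo]] := sigma_finiteT nu.
pose uncons (t : m.+1.-tuple T) : T * m.-tuple T :=
  (thead t, [tuple of behead t]).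
have consK : cancel tuple_cons uncons.
  by move=> [x t]; congr pair; exact/val_inj.
have muncons : measurable_fun setT uncons.
  apply/measurable_fun_pairP; split; first exact: measurable_tnth.
  exact: measurable_behead.
exists (fun k => uncons @^-1` (F k `*` G k)) => [|k].
  apply/esym; rewrite -subTset => t _.
  have [i _ Fi] : (\bigcup_k F k) (uncons t).1 by rewrite -TF.
  have [j _ Gj] : (\bigcup_k G k) (uncons t).2 by rewrite -TG.
  exists (maxn i j) => //; split.
    by move: Fi; exact/subsetPset/ndF/leq_maxl.
  by move: Gj; exact/subsetPset/ndG/leq_maxr.
have [mF Fk] := Foo k; have [mG Gk] := Goo k; split.
  by rewrite -[X in measurable X]setTI; apply: muncons => //;
     exact: measurableX.
rewrite /measure_cons /pushforward (_ : _ @^-1` _ = F k `*` G k).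
  by rewrite product_measure1E// lte_mul_pinfty// ge0_fin_numE.
by apply/seteqP; split=> p; rewrite /preimage /mkset consK.
Qed.

HB.instance Definition _ := @Measure_isSigmaFinite.Build _ _ _
  measure_cons measure_cons_sigma_finite.

End measure_cons.

Fixpoint lebesgue_measure_tuple (R : realType) (m : nat) :
    {sigma_finite_measure set (m.-tuple (measurableTypeR R)) -> \bar R} :=
  match m with
  | 0%N => \d_([tuple] : 0.-tuple (measurableTypeR R))
  | k.+1 => measure_cons (@lebesgue_measure R) (lebesgue_measure_tuple R k)
  end.

Section row_integral.
Context (R : realType) (m : nat).

Definition row_of_tuple (z : m.-tuple (measurableTypeR R)) : 'rV[R]_m :=
  \row_(b < m) tnth z b.

Definition row_integral (A : set 'rV[R]_m) (f : 'rV[R]_m -> \bar R) : \bar R :=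
  (\int[lebesgue_measure_tuple R m]_(z in row_of_tuple @^-1` A)
     f (row_of_tuple z))%E.

End row_integral.

(** * Smooth functions on relatively open subsets of a half-space *)

Section smooth.
Context (R : realType) (m : nat).
Implicit Types (f : 'rV[R]_m -> R) (y : 'rV[R]_m) (V : set 'rV[R]_m).

(* The first coordinate is nonnegative; for m = 0 this is the whole space. *)
Definition half_space : set 'rV[R]_m :=
  [set y | forall b : 'I_m, b = 0%N :> nat -> 0 <= y 0 b].

Definition diff_quotient (b : 'I_m) f y (h : R) : R :=
  h^-1 * (f (y + h *: delta_mx 0 b) - f y).

(* Increments stay in the half-space: at a boundary point the derivative in
   the normal direction is one-sided, all others are two-sided. *)
Definition increments (b : 'I_m) y : set_system R :=
  within [set h : R | half_space (y + h *: delta_mx 0 b)] 0^'.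

Definition partial (b : 'I_m) f y : R :=
  lim (diff_quotient b f y @ increments b y).

Definition partials (s : seq 'I_m) f : 'rV[R]_m -> R := foldr partial f s.

Definition smooth_on V f : Prop := forall s : seq 'I_m,
  {within V, continuous (partials s f)} /\
  forall b y, V y -> cvg (diff_quotient b (partials s f) y @ increments b y).

Definition open_in_half_space V : Prop :=
  exists2 O : set 'rV[R]_m, open O & V = O `&` half_space.

End smooth.

(** * Compact manifolds with boundary *)

(* Second countability follows from compactness. [chart] may index any smooth
   atlas; [chart_coord i] and [chart_param i] are mutually inverse between
   [chart_dom i] and its image by [chart_coord i], and arbitrary elsewhere. *)
Record compact_manifold (R : realType) (m : nat) := CompactManifold {
  carrier :> topologicalType;
  manifold_hausdorff : hausdorff_space carrier;
  manifold_compact : compact [set: carrier];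
  chart : Type;
  chart_dom : chart -> set carrier;
  chart_coord : chart -> carrier -> 'rV[R]_m;
  chart_param : chart -> 'rV[R]_m -> carrier;
  chart_dom_open : forall i, open (chart_dom i);
  chart_dom_cover : forall x, exists i, chart_dom i x;
  chart_paramK : forall i x, chart_dom i x -> chart_param i (chart_coord i x) = x;
  chart_coord_open : forall i, open_in_half_space (chart_coord i @` chart_dom i);
  chart_coord_continuous : forall i,
    {within chart_dom i, continuous (chart_coord i)};
  chart_param_continuous :
    forall i, {within chart_coord i @` chart_dom i, continuous (chart_param i)};
  transition_smooth : forall i j (a : 'I_m),
    smooth_on (chart_coord i @` (chart_dom i `&` chart_dom j))
      (fun y => chart_coord j (chart_param i y) 0 a)
}.

Arguments chart {R m}.
Arguments chart_dom {R m M} : rename.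
Arguments chart_coord {R m M} : rename.
Arguments chart_param {R m M} : rename.

Section manifold.
Context (R : realType) (m : nat) (M : compact_manifold R m).
Implicit Types (i j : chart M) (x : M).

(* Jacobian matrix at x of the change of coordinates from chart i to j. *)
Definition chart_jacobian i j x : 'M[R]_m :=
  \matrix_(a, b) partial b (fun y => chart_coord j (chart_param i y) 0 a)
                          (chart_coord i x).

Lemma finite_chart_cover :
  exists s : seq (chart M), forall x, exists k : 'I_(size s),
    chart_dom (tnth (in_tuple s) k) x.
Proof.
have : compact [set: M] := @manifold_compact _ _ M.
move=> /compact_near_coveringP cM; pose I := {classic chart M}.
pose F : set_system (seq I) :=
  [set S | exists s0 : seq I, forall s : seq I, {subset s0 <= s} -> S s].
have FF : Filter F.
  split; first by exists [::].
    move=> S S' [s0 Ss0] [s1 Ss1]; exists (s0 ++ s1) => s s01; split.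
      by apply: Ss0 => i is0; apply: s01; rewrite mem_cat is0.
    by apply: Ss1 => i is1; apply: s01; rewrite mem_cat is1 orbT.
  by move=> S S' SS' [s0 Ss0]; exists s0 => s /Ss0 /SS'.
have [|s0 /(_ s0 (fun=> id)) s0M] :=
    cM (seq I) F (fun s x => exists k : 'I_(size s),
      chart_dom (tnth (in_tuple s) k) x).
  move=> x _; have [i ix] := chart_dom_cover x.
  exists (chart_dom i, [set s : seq I | (i : I) \in s]) => [|[y s] /= [iy]].
    split; first by apply: open_nbhs_nbhs; split; first exact: chart_dom_open.
    by exists [:: i : I] => s /(_ i); apply; rewrite mem_head.
  by move=> /(tnthP (in_tuple s))[k ik]; exists k; rewrite -ik.
by exists s0 => x; apply: s0M.
Qed.

Definition chart_cover : seq (chart M) := projT1 (cid finite_chart_cover).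

(* The charts of the cover made disjoint. *)
Definition piece (k : 'I_(size chart_cover)) : set M :=
  chart_dom (tnth (in_tuple chart_cover) k) `\`
  \bigcup_(l in [set l : 'I_(size chart_cover) | (l < k)%N])
    chart_dom (tnth (in_tuple chart_cover) l).

(* The integral over M of a density, given by its coefficient [w i x] with
   respect to Lebesgue measure in the coordinates of each chart i around x.
   For a density it does not depend on the chosen cover. *)
Definition integral_density (w : chart M -> M -> \bar R) : \bar R :=
  (\sum_(k < size chart_cover)
    let i := tnth (in_tuple chart_cover) k in
    row_integral (chart_coord i @` piece k) (fun y => w i (chart_param i y)))%E.

(* A nowhere vanishing top-degree form, given by its coefficient in each
   chart; such a form exists only on an orientable manifold. *)
Record volume_form (mu : chart M -> M -> R) : Prop := {
  volume_form_neq0 : forall i x, chart_dom i x -> mu i x != 0;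
  volume_form_change : forall i j x, chart_dom i x -> chart_dom j x ->
    mu i x = mu j x * \det (chart_jacobian i j x);
  volume_form_smooth : forall i,
    smooth_on (chart_coord i @` chart_dom i) (fun y => mu i (chart_param i y))
}.

(* M being oriented by mu, hence the absolute value. *)
Definition integral_volume (mu : chart M -> M -> R)
    (f : chart M -> M -> \bar R) : \bar R :=
  integral_density (fun i x => f i x * `|mu i x|%:E)%E.

End manifold.

(** * Geodesic distance on an open subset of a locally convex space *)

Section geodesic_distance.
Context (R : realType) (E : lmodType R).
(* [W] is a linear subspace of [E]; [B k e], e > 0, is the open ball of radius
   e centered at 0 of the k-th seminorm of a family defining its topology; [P]
   is an open subset of [W] and [g] a Riemannian metric on [P]. *)
Variables (W : set E) (K : Type) (B : K -> R -> set E).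
Variables (P : set E) (g : E -> E -> E -> \bar R).

Definition has_velocity (t0 t1 : R) (c v : R -> E) : Prop :=
  forall t, t0 <= t <= t1 -> forall (k : K) (e : R), 0 < e ->
    \forall s \near within `[t0, t1] t^',
      B k e ((s - t)^-1 *: (c s - c t) - v t).

Definition smooth_curve (t0 t1 : R) (c v : R -> E) : Prop :=
  exists d : nat -> R -> E, [/\ d 0%N = c, d 1%N = v &
    forall j, (forall t, t0 <= t <= t1 -> W (d j t)) /\
              has_velocity t0 t1 (d j) (d j.+1)].

Definition path_lengths (p q : E) : set (\bar R) :=
  [set L | exists (c : R -> E) (N : nat) (t : nat -> R) (v : nat -> R -> E),
    [/\ c 0 = p /\ c 1 = q,
        forall s, 0 <= s <= 1 -> P (c s),
        t 0%N = 0 /\ t N = 1,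
        (forall k, (k < N)%N ->
           t k < t k.+1 /\ smooth_curve (t k) (t k.+1) c (v k)) &
        L = (\sum_(k < N) \int[lebesgue_measure]_(s in `[t k, t k.+1])
              sqrte (g (c s) (v k s) (v k s)))%E]].

Definition geodesic_dist (p q : E) : \bar R := ereal_inf (path_lengths p q).

End geodesic_distance.

(** * The space of full-rank matrices *)

Section matrix_distance.
Context (R : realType) (n m : nat).

Definition matrix_metric (a u v : 'M[R]_(n, m)) : R :=
  \tr (u *m invmx (a^T *m a) *m v^T) * Num.sqrt (\det (a^T *m a)).

Definition full_rank : set 'M[R]_(n, m) := [set a | \rank a = m].

Definition matrix_ball (_ : unit) (e : R) : set 'M[R]_(n, m) :=
  [set u | forall a b, `|u a b| < e].

Definition matrix_dist : 'M[R]_(n, m) -> 'M[R]_(n, m) -> \bar R :=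
  geodesic_dist setT matrix_ball full_rank
    (fun a u v => (matrix_metric a u v)%:E).

End matrix_distance.

(** * Vector-valued one-forms *)

Section one_forms.
Context (R : realType) (m n : nat) (M : compact_manifold R m).

(* [z i x] is the matrix of z(x) : T_x M -> R^n in the basis of T_x M given by
   chart i. It is set to 0 outside the domain of i, so that equality of
   one-forms is equality of functions. *)
Local Notation form := (chart M -> M -> 'M[R]_(n, m)).

Record one_form (z : form) : Prop := {
  one_form_out : forall i x, ~ chart_dom i x -> z i x = 0;
  one_form_change : forall i j x, chart_dom i x -> chart_dom j x ->
    z i x = z j x *m chart_jacobian i j x;
  one_form_smooth : forall i (a : 'I_n) (b : 'I_m),
    smooth_on (chart_coord i @` chart_dom i)
      (fun y => z i (chart_param i y) a b)
}.

Definition one_form_inj (z : form) : Prop :=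
  one_form z /\
  forall i x, chart_dom i x -> injective (fun v : 'cV[R]_m => z i x *m v).

(* The C^oo topology: uniform convergence of every partial derivative on every
   compact subset of every chart (other sets C impose no condition). The bound
   e' expresses that the supremum over C is less than e. *)
Definition form_ball (k : chart M * set 'rV[R]_m * seq 'I_m) (e : R) :
    set form :=
  let: (i, C, s) := k in
  [set z | compact C -> C `<=` chart_coord i @` chart_dom i ->
     exists2 e' : R, e' < e & forall y a b, C y ->
       `|partials s (fun y' => z i (chart_param i y') a b) y| <= e'].

Definition ebin_metric (al ze et : form) : \bar R :=
  integral_density (fun i x => (matrix_metric (al i x) (ze i x) (et i x))%:E).

Definition ebin_dist : form -> form -> \bar R :=
  geodesic_dist one_form form_ball one_form_inj ebin_metric.

(* A basis of T_x M of unit volume, in the coordinates of chart i. (For m = 0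
   there may be none, but then there is only one n x m matrix.) *)
Definition unit_basis (mu : chart M -> M -> R) (i : chart M) (x : M) :
    'M[R]_m :=
  xget 0 [set b : 'M[R]_m | mu i x * \det b = 1].

Definition pointwise_dist (mu : chart M -> M -> R) (al be : form)
    (i : chart M) (x : M) : \bar R :=
  matrix_dist (al i x *m unit_basis mu i x) (be i x *m unit_basis mu i x).

End one_forms.

(* Main.v *)
Require Import Defs.
From mathcomp Require Import all_boot all_order all_algebra.
From mathcomp Require Import all_classical all_reals all_analysis.
From mathcomp Require Import measurable_realfun.
From mathcomp Require Import ring lra.
From mathcomp Require polyrcf.

Set Implicit Arguments.
Unset Strict Implicit.
Unset Printing Implicit Defensive.

Import Order.TTheory GRing.Theory Num.Theory.
Import numFieldNormedType.Exports.

Local Open Scope classical_set_scope.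
Local Open Scope ring_scope.

(** Let [c] be a path of one-forms from [al] to [be]. At each point [x] it traces
    a path of matrices [c s i x], whose length [point_length] is the integral over
    [s] of the square root of the integrand of the Ebin metric. Minkowski's
    integral inequality exchanges the L2 norm over [M] with the integral over [s]:
    the L2 norm of [point_length] is at most the length of [c]
    ([integral_point_length_le]). Hence any lower bound [h x] of the squared
    lengths of the paths from [al i x] to [be i x] that does not depend on the path
    gives a lower bound of the squared distance ([le_ebin_dist_sqr]), and both
    claims are instances of this.

    For the inequality, [h] is the squared distance of the matrices in a basis
    of unit volume. Passing to a basis [b] multiplies the metric on matrices by
    [|det b|], and [|det b|] cancels the coefficient of the volume form
    ([matrix_dist_le_point_length], [pointwise_dist_le]).

    For non-degeneracy, the points of the space of full-rank matrices are
    separated by functions that are Lipschitz for its metric. Write a tangent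
    vector at [a] as [u = q a]. Its squared length is [|q|^2 D^(1/2)] with
    [D = det (a^T a)], while [D] changes at the rate [2 D tr q] by Jacobi's
    formula. So [D^(1/4) psi] is Lipschitz whenever [psi] is bounded and changes at a
    rate [O(|q|)]; the functions [1], [1 / (1 + |a|^2)] and [a_ij / (1 + |a|^2)]
    qualify, and together with [D^(1/4)] they determine [a] ([sep_inj], [dsep_le]).
    If [al] and [be] differ, one of these functions differs by at least a positive
    constant on a small box in a chart, so [h] may be taken to be a positive
    constant on a set of positive measure ([ebin_dist_gt0]).

    The joint measurability needed for Tonelli's theorem comes from continuity
    in the time [s] and continuity in the coordinates of [x], separately
    ([measurable_caratheodory]). *)

(** * The matrix metric *)

Section matrix_metric_algebra.
Context (R : realType) (n m : nat).
Implicit Types a u v : 'M[R]_(n, m).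

Definition gram a : 'M[R]_m := a^T *m a.

(** The Moore-Penrose inverse on matrices of full rank; this form of it is
    a rational function of the entries, continuous where the denominator
    does not vanish. *)
Definition pinv a : 'M[R]_(m, n) :=
  (\det (gram a))^-1 *: \adj (gram a) *m a^T.

Definition norm2 (p r : nat) (q : 'M[R]_(p, r)) : R := \sum_i \sum_j q i j ^+ 2.

Lemma norm2_ge0 p r (q : 'M[R]_(p, r)) : 0 <= norm2 q.
Proof. by apply: sumr_ge0 => i _; apply: sumr_ge0 => j _; apply: sqr_ge0. Qed.

Lemma norm2E p r (q : 'M[R]_(p, r)) : \tr (q *m q^T) = norm2 q.
Proof.
by apply: eq_bigr => i _; rewrite mxE; apply: eq_bigr => j _; rewrite mxE expr2.
Qed.

Lemma norm2_eq0 p r (q : 'M[R]_(p, r)) : norm2 q = 0 -> q = 0.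
Proof.
move=> /eqP; rewrite psumr_eq0 => [/allP q0|i _]; last first.
  by apply: sumr_ge0 => j _; apply: sqr_ge0.
apply/matrixP => i j; rewrite mxE; have /= := q0 i; rewrite mem_index_enum.
rewrite psumr_eq0 => [/(_ isT)/allP/(_ j)|k _]; last exact: sqr_ge0.
by rewrite mem_index_enum /= sqrf_eq0 => /(_ isT)/eqP.
Qed.

Lemma le_entry_norm2 p r (q : 'M[R]_(p, r)) i j : q i j ^+ 2 <= norm2 q.
Proof.
rewrite /norm2 (bigD1 i)//= (bigD1 j)//= -addrA lerDl addr_ge0//.
  by apply: sumr_ge0 => k _; apply: sqr_ge0.
by apply: sumr_ge0 => k _; apply: sumr_ge0 => l _; apply: sqr_ge0.
Qed.

Lemma full_rank_mulmx_eq0 p a (w : 'M[R]_(m, p)) :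
  \rank a = m -> a *m w = 0 -> w = 0.
Proof.
move=> ra aw0; apply: trmx_inj; rewrite trmx0.
have /row_freeP[b ab1] : row_free a^T by rewrite /row_free mxrank_tr ra.
by rewrite -[w^T]mulmx1 -ab1 mulmxA -trmx_mul aw0 trmx0 mul0mx.
Qed.

Lemma gramD_ker (x : R) a (w : 'rV[R]_m) : 0 <= x -> \rank a = m ->
  w *m gram a = - x *: w -> w = 0.
Proof.
move=> x0 ra wx; suff aw : a *m w^T = 0.
  by apply: trmx_inj; rewrite trmx0; apply: full_rank_mulmx_eq0 aw.
apply: norm2_eq0; apply/eqP; rewrite eq_le norm2_ge0 andbT -norm2E.
rewrite mxtrace_mulC trmx_mul trmxK mulmxA -(mulmxA w) -/(gram a) wx.
by rewrite -scalemxAl mxtraceZ norm2E mulNr oppr_le0 mulr_ge0// norm2_ge0.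
Qed.

Lemma gram_unit a : \rank a = m -> gram a \in unitmx.
Proof.
move=> ra; rewrite -row_free_unit -kermx_eq0; apply/eqP/row_matrixP => i.
rewrite row0; apply: (@gramD_ker 0 a) => //.
by rewrite oppr0 scale0r -row_mul mulmx_ker row0.
Qed.

(** The monic polynomial [det (X + gram a)] has no root [x >= 0], as [gram a]
    has no nonpositive eigenvalue; hence it is positive at [0]. *)
Lemma gram_det_gt0 a : \rank a = m -> 0 < \det (gram a).
Proof.
move=> ra; set p := char_poly (- gram a).
have pE : p.[0] = \det (gram a).
  rewrite horner_coef0 char_poly_det -(scaleN1r (gram a)) detZ mulrA -exprD addnn.
  by rewrite -mul2n exprM sqrrN expr1n expr1n mul1r.
have p0 x : 0 <= x -> p.[x] != 0.
  move=> x0; apply/negP; rewrite -/(root p x) -eigenvalue_root_char.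
  move=> /eigenvalueP[w wx w0]; move: w0; rewrite (@gramD_ker x a w) ?eqxx//.
  by rewrite scaleNr -wx mulmxN opprK.
rewrite lt_neqAle -pE eq_sym p0//= leNgt; apply/negP => pneg.
have lp : 0 < lead_coef p by rewrite (monicP (char_poly_monic _)).
have [N Np] := polyrcf.poly_pinfty_gt_lc lp.
have [] := @poly_ivt _ p 0 (Num.max 0 N).
- by rewrite le_max lexx.
- rewrite (ltW pneg)/=; apply: (le_trans (ltW lp)); apply: Np.
  by rewrite le_max lexx orbT.
by move=> x /andP[x0 _]; rewrite /root (negPf (p0 x x0)).
Qed.

Lemma full_rank_inj a : injective (fun w : 'cV[R]_m => a *m w) -> \rank a = m.
Proof.
move=> ainj; apply/eqP; rewrite -mxrank_tr -/(row_free _) -kermx_eq0.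
apply/eqP/row_matrixP => i; rewrite row0; apply: trmx_inj; rewrite trmx0.
apply: ainj; rewrite mulmx0; apply: trmx_inj.
by rewrite trmx_mul trmxK trmx0 -row_mul mulmx_ker row0.
Qed.

Lemma pinvE a : \rank a = m -> pinv a = invmx (gram a) *m a^T.
Proof. by move=> ra; rewrite /pinv /invmx gram_unit. Qed.

Lemma mul_pinv a : \rank a = m -> pinv a *m a = 1%:M.
Proof. by move=> ra; rewrite pinvE// -mulmxA mulVmx// gram_unit. Qed.

Lemma trmx_gram a : (gram a)^T = gram a.
Proof. by rewrite trmx_mul trmxK. Qed.

(** With [q = u *m pinv a], which satisfies [u = q *m a], the metric is a
    Euclidean norm of [q] times the volume factor. *)
Lemma matrix_metricE a u : \rank a = m ->
  matrix_metric a u u = norm2 (u *m pinv a) * Num.sqrt (\det (gram a)).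
Proof.
move=> ra; rewrite /matrix_metric -/(gram a) -norm2E pinvE//; congr (\tr _ * _).
rewrite !trmx_mul trmxK trmx_inv trmx_gram !mulmxA.
rewrite -[_ *m a^T *m a]mulmxA -/(gram a).
by rewrite -[_ *m gram a]mulmxA mulVmx ?gram_unit// mulmx1.
Qed.

Lemma matrix_metric_ge0 a u : \rank a = m -> 0 <= matrix_metric a u u.
Proof. by move=> ra; rewrite matrix_metricE// mulr_ge0 ?norm2_ge0. Qed.

Lemma matrix_metric_mulmx a u v (b : 'M[R]_m) : \rank a = m -> b \in unitmx ->
  matrix_metric (a *m b) (u *m b) (v *m b) = `|\det b| * matrix_metric a u v.
Proof.
move=> ra ub; rewrite /matrix_metric.
have -> : (a *m b)^T *m (a *m b) = b^T *m gram a *m b.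
  by rewrite trmx_mul !mulmxA.
have ubT : b^T \in unitmx by rewrite unitmx_tr.
have -> : invmx (b^T *m gram a *m b) = invmx b *m invmx (gram a) *m invmx b^T.
  have uX : b^T *m gram a *m b \in unitmx by rewrite !unitmx_mul ubT gram_unit.
  apply: (row_free_inj (_ : row_free (b^T *m gram a *m b))).
    by rewrite row_free_unit.
  rewrite mulVmx// -!mulmxA mulKmx// (mulmxA a^T) -/(gram a).
  by rewrite (mulKmx (gram_unit ra)) mulVmx.
rewrite trmx_mul !det_mulmx det_tr -/(gram a) !mulmxA.
rewrite mulmxK// -(mulmxA _ (invmx b^T)) mulVmx// mulmx1.
rewrite mulrAC -expr2 sqrtrM ?sqr_ge0// sqrtr_sqr.
by rewrite mulrCA.
Qed.

End matrix_metric_algebra.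

(** * Differentiating along a curve of matrices *)

Section scalar_derivatives.
Context (R : realType).
Implicit Types (f g : R -> R) (t df dg : R).

Lemma is_derive_mul f g t df dg : is_derive t 1 f df -> is_derive t 1 g dg ->
  is_derive t 1 (fun s => f s * g s) (f t * dg + g t * df).
Proof. by move=> *; apply: is_deriveM. Qed.

Lemma is_derive_big_sum (I : Type) (r : seq I) (P : pred I)
    (F : I -> R -> R) (dF : I -> R) t :
  (forall i, P i -> is_derive t 1 (F i) (dF i)) ->
  is_derive t 1 (fun s => \sum_(i <- r | P i) F i s) (\sum_(i <- r | P i) dF i).
Proof.
move=> FdF; elim: r => [|i r IH].
  rewrite big_nil; have -> : (fun s => \sum_(i <- [::] | P i) F i s) = cst 0.
    by apply/funext => s; rewrite big_nil.
  exact: is_derive_cst.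
have -> : (fun s => \sum_(j <- i :: r | P j) F j s) =
    if P i then F i \+ (fun s => \sum_(j <- r | P j) F j s)
    else fun s => \sum_(j <- r | P j) F j s.
  by apply/funext => s; rewrite big_cons; case: ifP.
by rewrite big_cons; case: ifPn => // Pi; apply: is_deriveD; first exact: FdF.
Qed.

Lemma is_derive_big_prod (k : nat) (F : 'I_k -> R -> R) (dF : 'I_k -> R) t :
  (forall i, is_derive t 1 (F i) (dF i)) ->
  is_derive t 1 (fun s => \prod_i F i s)
    (\sum_i dF i * \prod_(j | j != i) F j t).
Proof.
elim: k F dF => [|k IH] F dF FdF.
  rewrite big_ord0; have -> : (fun s => \prod_(i < 0) F i s) = cst 1.
    by apply/funext => s; rewrite big_ord0.
  exact: is_derive_cst.
have -> : (fun s => \prod_(i < k.+1) F i s) =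
    fun s => F ord0 s * \prod_(i < k) F (lift ord0 i) s.
  by apply/funext => s; rewrite big_ord_recl.
have /= := is_derive_mul (FdF ord0) (IH _ _ (fun i => FdF (lift ord0 i))).
move/is_derive_eq; apply.
rewrite big_ord_recl addrC; congr +%R.
  rewrite mulrC [in RHS]big_mkcond big_ord_recl /= mul1r.
  by congr (_ * _); apply: eq_bigr.
rewrite mulr_sumr; apply: eq_bigr => i _; rewrite mulrCA; congr (_ * _).
rewrite [in RHS]big_mkcond big_ord_recl /=; congr (_ * _).
by rewrite big_mkcond; apply: eq_bigr => j _; rewrite (inj_eq lift_inj).
Qed.

(** Jacobi's formula: each term of the Leibniz expansion is differentiated one
    factor at a time, and collecting the terms where row [i] is differentiated
    gives the expansion of a determinant along row [i]. *)
Lemma is_derive_det (k : nat) (A : R -> 'M[R]_k) (B : 'M[R]_k) t :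
  (forall i j, is_derive t 1 (fun s => A s i j) (B i j)) ->
  is_derive t 1 (fun s => \det (A s)) (\tr (B *m \adj (A t))).
Proof.
move=> AB; pose Ai i := \matrix_(j, l) if j == i then B i l else A t j l.
have detAi i : \det (Ai i) = (B *m \adj (A t)) i i.
  rewrite (expand_det_row _ i) [RHS]mxE; apply: eq_bigr => j _.
  rewrite !mxE eqxx; congr (_ * (_ * \det _)); apply/matrixP => l r.
  by rewrite !mxE eq_sym (negPf (neq_lift _ _)).
rewrite /mxtrace; under eq_bigr do rewrite -detAi; rewrite exchange_big /=.
apply: is_derive_big_sum => s _.
apply: is_derive_eq.
  apply: (is_derive_mul (f := cst _)).
  by apply: is_derive_big_prod => i; apply: AB.
rewrite mulr0 addr0 mulr_sumr; apply: eq_bigr => i _; congr (_ * _).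
rewrite [RHS](bigD1 i)//= mxE eqxx; congr (_ * _).
by apply: eq_bigr => j ji; rewrite mxE (negPf ji).
Qed.

End scalar_derivatives.

(** * Continuity of functions of the entries of a matrix *)

Section entrywise_convergence.
Context (R : realType) (T : Type) (F : set_system T) (FF : Filter F).

Definition mxcvg (p r : nat) (a : T -> 'M[R]_(p, r)) (l : 'M[R]_(p, r)) : Prop :=
  forall i j, a x i j @[x --> F] --> l i j.

Lemma cvg_sum_fun (I : Type) (r : seq I) (f : I -> T -> R) (l : I -> R) :
  (forall i, f i x @[x --> F] --> l i) ->
  \sum_(i <- r) f i x @[x --> F] --> \sum_(i <- r) l i.
Proof.
by move=> fl; apply: cvg_big => //; apply: add_continuous.
Qed.

Lemma cvg_prod_fun (I : Type) (r : seq I) (f : I -> T -> R) (l : I -> R) :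
  (forall i, f i x @[x --> F] --> l i) ->
  \prod_(i <- r) f i x @[x --> F] --> \prod_(i <- r) l i.
Proof.
by move=> fl; apply: cvg_big => //; apply: mul_continuous.
Qed.

Lemma mxcvg_mul p q r (a : T -> 'M[R]_(p, q)) (b : T -> 'M[R]_(q, r)) la lb :
  mxcvg a la -> mxcvg b lb -> mxcvg (fun x => a x *m b x) (la *m lb).
Proof.
move=> ca cb i j; rewrite mxE; under eq_cvg do rewrite mxE.
by apply: cvg_sum_fun => k; apply: cvgM.
Qed.

Lemma mxcvg_tr p q (a : T -> 'M[R]_(p, q)) la :
  mxcvg a la -> mxcvg (fun x => (a x)^T) la^T.
Proof. move=> ca i j; by rewrite mxE; under eq_cvg do rewrite mxE; apply: ca. Qed.

Lemma cvg_det p (a : T -> 'M[R]_p) la :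
  mxcvg a la -> (\det (a x)) @[x --> F] --> (\det la).
Proof.
move=> ca; apply: cvg_sum_fun => s; apply: cvgM; first exact: cvg_cst.
by apply: cvg_prod_fun.
Qed.

Lemma cvg_mxtrace p (a : T -> 'M[R]_p) la :
  mxcvg a la -> (\tr (a x)) @[x --> F] --> (\tr la).
Proof. by move=> ca; apply: cvg_sum_fun. Qed.

Lemma mxcvg_adj p (a : T -> 'M[R]_p) la :
  mxcvg a la -> mxcvg (fun x => \adj (a x)) (\adj la).
Proof.
move=> ca i j; rewrite mxE; under eq_cvg do rewrite mxE.
apply: cvgM; first exact: cvg_cst; apply: cvg_det => k l.
by rewrite !mxE; under eq_cvg do rewrite !mxE; apply: ca.
Qed.

Lemma mxcvg_gram p q (a : T -> 'M[R]_(p, q)) la :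
  mxcvg a la -> mxcvg (fun x => gram (a x)) (gram la).
Proof. by move=> ca; apply: mxcvg_mul => //; apply: mxcvg_tr. Qed.

Lemma mxcvg_pinv p q (a : T -> 'M[R]_(p, q)) la :
  \rank la = q -> mxcvg a la -> mxcvg (fun x => pinv (a x)) (pinv la).
Proof.
move=> rla ca; apply: mxcvg_mul; last exact: mxcvg_tr.
move=> i j; rewrite mxE; under eq_cvg do rewrite mxE.
apply: cvgM; last by apply: mxcvg_adj; apply: mxcvg_gram.
apply: cvgV; first by rewrite gt_eqF// gram_det_gt0.
by apply: cvg_det; apply: mxcvg_gram.
Qed.

Lemma cvg_norm2 p q (a : T -> 'M[R]_(p, q)) la :
  mxcvg a la -> norm2 (a x) @[x --> F] --> norm2 la.
Proof.
move=> ca; apply: cvg_sum_fun => i; apply: cvg_sum_fun => j.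
by under eq_cvg do rewrite expr2; rewrite expr2; apply: cvgM.
Qed.

End entrywise_convergence.

(** * Separating functions that are Lipschitz for the metric *)

Section lipschitz_functions.
Context (R : realType) (n m : nat).
Implicit Types (a u : 'M[R]_(n, m)) (o : option (option ('I_n * 'I_m))).

Definition root4 a : R := Num.sqrt (Num.sqrt (\det (gram a))).

(** The length of [u] for the metric at a matrix of full rank, in a form that
    makes its continuity apparent. *)
Definition speed a u : R := Num.sqrt (norm2 (u *m pinv a)) * root4 a.

Lemma speedE a u : \rank a = m -> speed a u = Num.sqrt (matrix_metric a u u).
Proof. by move=> ra; rewrite matrix_metricE// sqrtrM// norm2_ge0. Qed.

Lemma speed_ge0 a u : 0 <= speed a u.
Proof. by rewrite mulr_ge0 ?sqrtr_ge0. Qed.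

(** The matrix [a] can be recovered from these bounded functions. *)
Definition psi o a : R := match o with
  | None => 1
  | Some None => (1 + norm2 a)^-1
  | Some (Some (i, j)) => a i j * (1 + norm2 a)^-1
  end.

Definition dot a u : R := \sum_i \sum_j a i j * u i j.

Definition dpsi o a u : R := match o with
  | None => 0
  | Some None => - (1 + norm2 a) ^- 2 * (2 * dot a u)
  | Some (Some (i, j)) =>
      a i j * (- (1 + norm2 a) ^- 2 * (2 * dot a u)) + (1 + norm2 a)^-1 * u i j
  end.

(** [sep] separates the matrices of full rank, and its differential [dsep] is
    bounded by [speed]: the factor [root4] makes up for the volume factor of
    the metric, and [psi] is bounded, with [|dpsi a u|] at most a constant
    times the norm of [u *m pinv a]. *)
Definition sep o a : R := root4 a * psi o a.

Definition dsep o a u : R :=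
  root4 a * (\tr (u *m pinv a) / 2 * psi o a + dpsi o a u).

Lemma N1_gt0 a : 0 < 1 + norm2 a.
Proof. by rewrite ltr_pwDl ?norm2_ge0. Qed.

Lemma N1_neq0 a : 1 + norm2 a != 0.
Proof. by rewrite gt_eqF ?N1_gt0. Qed.

Lemma root4_gt0 a : \rank a = m -> 0 < root4 a.
Proof. by move=> ra; rewrite !sqrtr_gt0 gram_det_gt0. Qed.

Lemma sep_inj a b : \rank a = m -> \rank b = m ->
  (forall o, sep o a = sep o b) -> a = b.
Proof.
move=> ra rb ab; have := ab None; rewrite /sep/= !mulr1 => r4.
have pE o : psi o a = psi o b.
  by apply: (mulfI (lt0r_neq0 (root4_gt0 ra))); rewrite {2}r4; apply: ab.
apply/matrixP => i j; have := pE (Some (Some (i, j))); rewrite /= => abij.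
have := pE (Some None); rewrite /= => /invr_inj N.
by move: abij; rewrite N => /mulIf; apply; rewrite invr_eq0 N1_neq0.
Qed.

Lemma cvg_dot T (F : set_system T) (FF : Filter F) (a u : T -> 'M[R]_(n, m))
    la lu :
  mxcvg F a la -> mxcvg F u lu -> dot (a x) (u x) @[x --> F] --> dot la lu.
Proof.
by move=> ca cu; apply: cvg_sum_fun => i; apply: cvg_sum_fun => j; apply: cvgM.
Qed.

Section cvg.
Context (T : Type) (F : set_system T) (FF : Filter F).
Variables (a u : T -> 'M[R]_(n, m)) (la lu : 'M[R]_(n, m)).
Hypotheses (rla : \rank la = m) (ca : mxcvg F a la) (cu : mxcvg F u lu).

Lemma cvg_sqrt (f : T -> R) l :
  f x @[x --> F] --> l -> Num.sqrt (f x) @[x --> F] --> Num.sqrt l.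
Proof.
by move=> cf; have := continuous_cvg _ (@sqrt_continuous R l) cf; exact.
Qed.

Lemma cvg_root4 : root4 (a x) @[x --> F] --> root4 la.
Proof.
apply: cvg_sqrt; apply: cvg_sqrt.
by apply: cvg_det; apply: mxcvg_gram.
Qed.

Lemma cvg_speed : speed (a x) (u x) @[x --> F] --> speed la lu.
Proof.
apply: cvgM; last exact: cvg_root4.
apply: cvg_sqrt.
by apply: cvg_norm2; apply: mxcvg_mul => //; apply: mxcvg_pinv.
Qed.

Lemma cvg_N1V : (1 + norm2 (a x))^-1 @[x --> F] --> (1 + norm2 la)^-1.
Proof.
apply: cvgV; first exact: N1_neq0.
by apply: cvgD; [apply: cvg_cst|apply: cvg_norm2].
Qed.

Lemma cvg_psi o : psi o (a x) @[x --> F] --> psi o la.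
Proof.
case: o => [[[i j]|]|] /=; [|exact: cvg_N1V|exact: cvg_cst].
by apply: cvgM; [apply: ca|apply: cvg_N1V].
Qed.

Lemma cvg_sep o : sep o (a x) @[x --> F] --> sep o la.
Proof. by apply: cvgM; [apply: cvg_root4|apply: cvg_psi]. Qed.

Lemma cvg_dsep o : dsep o (a x) (u x) @[x --> F] --> dsep o la lu.
Proof.
apply: cvgM; first exact: cvg_root4; apply: cvgD.
  apply: cvgM; last exact: cvg_psi; apply: cvgM; last exact: cvg_cst.
  by apply: cvg_mxtrace; apply: mxcvg_mul => //; apply: mxcvg_pinv.
have cN2 : - (1 + norm2 (a x)) ^- 2 * (2 * dot (a x) (u x)) @[x --> F] -->
    - (1 + norm2 la) ^- 2 * (2 * dot la lu).
  apply: cvgM; last by apply: cvgM; [apply: cvg_cst|apply: cvg_dot].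
  apply: cvgN; rewrite -exprVn; under eq_cvg do rewrite -exprVn expr2.
  by rewrite expr2; apply: cvgM; apply: cvg_N1V.
case: o => [[[i j]|]|] /=; [|exact: cN2|exact: cvg_cst].
apply: cvgD; first by apply: cvgM; [apply: ca|].
by apply: cvgM; [apply: cvg_N1V|apply: cu].
Qed.

End cvg.

Section derivative.
Variables (c : R -> 'M[R]_(n, m)) (u : 'M[R]_(n, m)) (t : R).
Hypotheses (rc : \rank (c t) = m)
  (cu : forall i j, is_derive t 1 (fun s => c s i j) (u i j)).

(** The relative speed of the volume of [c] is the trace of [u *m pinv c]. *)
Lemma is_derive_det_gram : is_derive t 1 (fun s => \det (gram (c s)))
  (2 * \det (gram (c t)) * \tr (u *m pinv (c t))).
Proof.
apply: is_derive_eq.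
  apply: (@is_derive_det _ _ _ (u^T *m c t + (c t)^T *m u)) => i j.
  have -> : (fun s => gram (c s) i j) = fun s => \sum_k c s k i * c s k j.
    by apply/funext => s; rewrite mxE; apply: eq_bigr => k _; rewrite mxE.
  apply: is_derive_eq.
    by apply: is_derive_big_sum => k _; apply: is_derive_mul; apply: cu.
  rewrite !mxE -big_split; apply: eq_bigr => k _ /=; rewrite !mxE.
  by rewrite addrC; congr +%R; apply: mulrC.
have D0 : \det (gram (c t)) != 0 by rewrite gt_eqF ?gram_det_gt0.
have -> : \adj (gram (c t)) = \det (gram (c t)) *: invmx (gram (c t)).
  by rewrite /invmx gram_unit// scalerA divff// scale1r.
rewrite -scalemxAr mxtraceZ (mulrC 2) -mulrA; congr (_ * _).
rewrite mulmxDl mxtraceD mulr_natl mulr2n pinvE//; congr +%R.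
  rewrite -mxtrace_tr !trmx_mul trmxK trmx_inv trmx_gram.
  by rewrite mulmxA [in RHS]mxtrace_mulC.
by rewrite -mulmxA mxtrace_mulC mulmxA.
Qed.

Lemma is_derive_root4 : is_derive t 1 (fun s => root4 (c s))
  (root4 (c t) * (\tr (u *m pinv (c t)) / 2)).
Proof.
have D0 := gram_det_gt0 rc; set D := \det _ in D0 *.
have sD0 : 0 < Num.sqrt D by rewrite sqrtr_gt0.
apply: is_derive_eq.
  apply: (is_derive1_comp (f := Num.sqrt)); first exact: is_derive1_sqrt.
  apply: (is_derive1_comp (f := Num.sqrt)); first exact: is_derive1_sqrt.
  exact: is_derive_det_gram.
rewrite /root4 -/D; set s := Num.sqrt D in sD0 *; set r := Num.sqrt s.
have r0 : 0 < r by rewrite sqrtr_gt0.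
have sE : s = r ^+ 2 by rewrite sqr_sqrtr// ltW.
have -> : D = s ^+ 2 by rewrite sqr_sqrtr// ltW.
by rewrite sE; field; rewrite gt_eqF.
Qed.

Lemma is_derive_N1V : is_derive t 1 (fun s => (1 + norm2 (c s))^-1)
  (- (1 + norm2 (c t)) ^- 2 * (2 * dot (c t) u)).
Proof.
apply: is_deriveV; first exact: N1_neq0.
rewrite -[2 * _]add0r; apply: is_deriveD; rewrite mulr_sumr.
apply: is_derive_big_sum => i _; rewrite mulr_sumr.
apply: is_derive_big_sum => j _.
have -> : 2 * (c t i j * u i j) = c t i j * u i j + c t i j * u i j by ring.
exact: is_derive_mul.
Qed.

Lemma is_derive_sep o : is_derive t 1 (fun s => sep o (c s)) (dsep o (c t) u).
Proof.
have dpsio : is_derive t 1 (fun s => psi o (c s)) (dpsi o (c t) u).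
  case: o => [[[i j]|]|] /=.
  - exact: is_derive_mul (cu i j) is_derive_N1V.
  - exact: is_derive_N1V.
  - exact: is_derive_cst.
have /is_derive_eq := is_derive_mul is_derive_root4 dpsio; apply.
by rewrite /dsep; ring.
Qed.

End derivative.

Lemma le_normr_entry p r (q : 'M[R]_(p, r)) i j :
  `|q i j| <= Num.sqrt (norm2 q).
Proof. by rewrite -sqrtr_sqr ler_wsqrtr// le_entry_norm2. Qed.

Lemma le_entry_N1 a i j : `|a i j| <= 1 + norm2 a.
Proof.
have := le_entry_norm2 a i j; have := sqr_ge0 (`|a i j| - 1).
by rewrite -(real_normK (num_real (a i j))); nra.
Qed.

Lemma ler_dot_mulmx (q : 'M[R]_n) a :
  `|dot a (q *m a)| <= n%:R * Num.sqrt (norm2 q) * norm2 a.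
Proof.
set Q := Num.sqrt _.
have -> : n%:R * Q * norm2 a =
    \sum_i \sum_j \sum_k Q * ((a i j ^+ 2 + a k j ^+ 2) / 2).
  have S1 : \sum_(i < n) \sum_(j < m) \sum_(k < n) a i j ^+ 2 = n%:R * norm2 a.
    rewrite mulr_sumr; apply: eq_bigr => i _; rewrite mulr_sumr.
    by apply: eq_bigr => j _; rewrite sumr_const card_ord mulr_natl.
  have S2 : \sum_(i < n) \sum_(j < m) \sum_(k < n) a k j ^+ 2 = n%:R * norm2 a.
    rewrite sumr_const card_ord mulr_natl; congr (_ *+ _).
    by rewrite exchange_big.
  transitivity (Q * ((n%:R * norm2 a + n%:R * norm2 a) / 2)); first by field.
  rewrite -{1}S1 -S2 -big_split/= mulr_suml mulr_sumr; apply: eq_bigr => i _.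
  rewrite -big_split/= mulr_suml mulr_sumr; apply: eq_bigr => j _.
  by rewrite -big_split/= mulr_suml mulr_sumr.
apply: le_trans (ler_norm_sum _ _ _) _; apply: ler_sum => i _.
apply: le_trans (ler_norm_sum _ _ _) _; apply: ler_sum => j _.
rewrite mxE mulr_sumr.
apply: le_trans (ler_norm_sum _ _ _) _; apply: ler_sum => k _.
rewrite mulrCA normrM; apply: ler_pM => //; first exact: le_normr_entry.
rewrite normrM -(real_normK (num_real (a i j))) -(real_normK (num_real (a k j))).
by have := sqr_ge0 (`|a i j| - `|a k j|); nra.
Qed.

Lemma ler_entry_mulmx (q : 'M[R]_n) a i j :
  `|(q *m a) i j| <= n%:R * Num.sqrt (norm2 q) * (1 + norm2 a).
Proof.
rewrite mxE; apply: le_trans (ler_norm_sum _ _ _) _.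
rewrite -mulrA mulr_natl -[n in _ *+ n]card_ord -sumr_const.
apply: ler_sum => k _; rewrite normrM; apply: ler_pM => //.
  exact: le_normr_entry.
exact: le_entry_N1.
Qed.

(** The summand [1] only serves to make the constant positive for [n = 0]. *)
Definition sep_bound : R := 4 * n%:R + 1.

(** Each entry of [q = u *m pinv a] is at most the norm of [q], which bounds the
    trace of [q] and the entries of [u = q *m a]; the denominators [1 + |a|^2] of
    [psi] absorb the growth of the latter. *)
Lemma dsep_le o a u : \rank a = m -> `|dsep o a u| <= sep_bound * speed a u.
Proof.
move=> ra; set q := u *m pinv a; set Q := Num.sqrt (norm2 q).
have qa : u = q *m a by rewrite -mulmxA mul_pinv// mulmx1.
have nQ : 0 <= n%:R * Q by rewrite mulr_ge0 ?sqrtr_ge0.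
have Npos := N1_gt0 a; have N0 := norm2_ge0 a.
have tq : `|\tr q| <= n%:R * Q.
  apply: le_trans (ler_norm_sum _ _ _) _.
  rewrite mulr_natl -[n in _ *+ n]card_ord -sumr_const.
  by apply: ler_sum => k _; apply: le_normr_entry.
have psi1 : `|psi o a| <= 1.
  case: o => [[[i j]|]|] /=; last by rewrite normr1.
    by rewrite normrM normfV (gtr0_norm Npos) ler_pdivrMr// mul1r le_entry_N1.
  by rewrite normfV gtr0_norm// invf_le1// lerDl.
have dN : `|- (1 + norm2 a) ^- 2 * (2 * dot a u)| * (1 + norm2 a)
    <= 2 * (n%:R * Q).
  rewrite normrM normrN normfV normrX (gtr0_norm Npos) normrM normr_nat.
  have := ler_dot_mulmx q a; rewrite -qa -/Q => dotle.
  have -> : (1 + norm2 a) ^- 2 * (2 * `|dot a u|) * (1 + norm2 a) =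
      2 * `|dot a u| / (1 + norm2 a) by field; exact: N1_neq0.
  rewrite ler_pdivrMr// -mulrA ler_pM2l//; apply: le_trans dotle _.
  by rewrite ler_wpM2l// lerDr.
have dN' : `|- (1 + norm2 a) ^- 2 * (2 * dot a u)| <= 2 * (n%:R * Q).
  apply: le_trans dN; rewrite ler_peMr// lerDl//.
have dpsi1 : `|dpsi o a u| <= 3 * (n%:R * Q).
  case: o {psi1} => [[[i j]|]|] /=.
  - apply: le_trans (ler_normD _ _) _.
    rewrite (_ : 3 * _ = 2 * (n%:R * Q) + n%:R * Q); last by ring.
    apply: lerD.
      rewrite normrM; apply: le_trans dN; rewrite mulrC.
      by apply: ler_wpM2l => //; apply: le_entry_N1.
    rewrite normrM normfV (gtr0_norm Npos) mulrC ler_pdivrMr// qa.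
    exact: ler_entry_mulmx.
  - by apply: le_trans dN' _; lra.
  - by rewrite normr0 mulr_ge0.
have r4 : 0 < root4 a := root4_gt0 ra.
rewrite /dsep /speed -/q -/Q normrM gtr0_norm// [sep_bound * _]mulrA.
rewrite [leRHS]mulrC ler_pM2l//; apply: le_trans (ler_normD _ _) _.
have : `|\tr q / 2 * psi o a| <= n%:R * Q * 1.
  rewrite normrM; apply: ler_pM => //; rewrite normrM normfV normr_nat.
  by apply: le_trans tq; rewrite ler_pdivrMr// ler_peMr// ler1n.
have Q0 : 0 <= Q by rewrite sqrtr_ge0.
have -> : sep_bound * Q = 4 * (n%:R * Q) + Q by rewrite /sep_bound; ring.
by lra.
Qed.

End lipschitz_functions.

(** * Curves of matrices *)

Section matrix_curves.
Context (R : realType) (n m : nat).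
Implicit Types (c v w : R -> 'M[R]_(n, m)).

Notation velocity := (has_velocity (@matrix_ball R n m)).

Definition mxcontinuous (t0 t1 : R) c := forall t, t0 <= t <= t1 ->
  mxcvg (within `[t0, t1] (nbhs t)) c (c t).

Lemma velocity_entry t0 t1 c v t i j e : velocity t0 t1 c v -> t0 <= t <= t1 ->
  0 < e -> \forall s \near t, t0 <= s <= t1 -> s != t ->
    `|(s - t)^-1 * (c s i j - c t i j) - v t i j| < e.
Proof.
move=> cv tI e0; have := cv t tI tt e e0.
rewrite /within/= near_withinE near_withinE => H; near=> s => sI st.
have := near H s _ st; rewrite /= in_itv/= => /(_ _ sI i j); rewrite !mxE; apply.
by [].
Unshelve. all: by end_near. Qed.

Lemma velocity_continuous t0 t1 c v : velocity t0 t1 c v -> mxcontinuous t0 t1 c.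
Proof.
move=> cv t tI i j; apply/cvgrPdist_lt => e e0; near_simpl.
rewrite near_withinE; pose K := `|v t i j| + 1.
have K0 : 0 < K by rewrite ltr_wpDl.
near=> s; rewrite /= in_itv/= => sI.
have [->|snt] := eqVneq s t; first by rewrite subrr normr0.
have qv : `|(s - t)^-1 * (c s i j - c t i j) - v t i j| < 1.
  by move: sI snt; near: s; exact: velocity_entry.
have qK : `|(s - t)^-1 * (c s i j - c t i j)| < K.
  rewrite -[X in `|X|](subrK (v t i j)); apply: le_lt_trans (ler_normD _ _) _.
  by rewrite addrC ltrD2l.
rewrite distrC -[_ - _](mulVKf (_ : s - t != 0)) ?subr_eq0// normrM.
apply: (@le_lt_trans _ _ (`|s - t| * K)).
  by rewrite ler_wpM2l// ltW.
rewrite -ltr_pdivlMr// distrC; near: s.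
by apply: cvgr_dist_lt; [exact: cvg_id|rewrite divr_gt0].
Unshelve. all: by end_near. Qed.

Lemma velocity_is_derive t0 t1 c v t i j : velocity t0 t1 c v ->
  t0 < t < t1 -> is_derive t 1 (fun s => c s i j) (v t i j).
Proof.
move=> cv /andP[t0t tt1]; have tI : t0 <= t <= t1 by rewrite !ltW.
suff H : h^-1 *: (((fun s => c s i j) \o shift t) (h *: 1) - c t i j)
    @[h --> 0^'] --> v t i j.
  by split; [apply/cvg_ex; exists (v t i j)|apply: cvg_lim].
apply/cvgrPdist_lt => e e0; rewrite near_withinE.
have : \forall s \near t, t0 < s < t1.
  near=> s; have : s \in `]t0, t1[; last by rewrite in_itv.
  by near: s; apply: near_in_itvoo; rewrite in_itv/= t0t.
have := velocity_entry i j cv tI e0.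
rewrite (near_shift 0)/= subr0 => H1; rewrite (near_shift 0)/= subr0 => H2.
near=> h => /= h0; rewrite distrC.
have /andP[t0h ht1] : t0 < h + t < t1 by near: h.
have : t0 <= h + t <= t1 -> h + t != t ->
    `|(h + t - t)^-1 * (c (h + t) i j - c t i j) - v t i j| < e by near: h.
rewrite !ltW//= addrK [_%:A]mulr1; apply => //.
by rewrite -subr_eq0 addrK.
Unshelve. all: by end_near. Qed.

(** Along a curve the separating functions change by at most a constant times
    the length. *)
Lemma sep_le_length t0 t1 c v w o : t0 < t1 ->
  velocity t0 t1 c v -> velocity t0 t1 v w ->
  (forall t, t0 <= t <= t1 -> \rank (c t) = m) ->
  (`|sep o (c t1) - sep o (c t0)|%:E <= (sep_bound R n)%:E *
    \int[lebesgue_measure]_(s in `[t0, t1]) (speed (c s) (v s))%:E)%E.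
Proof.
move=> t01 cv vw rc.
have cc := velocity_continuous cv; have cv' := velocity_continuous vw.
have mI : measurable (`[t0, t1] : set (measurableTypeR R)) by [].
have cs : {within `[t0, t1], continuous (fun s => speed (c s) (v s))}.
  apply/subspace_continuousP => t; rewrite /= in_itv/= => tI.
  by apply: cvg_speed; [exact: rc|exact: cc|exact: cv'].
have cd : {within `[t0, t1], continuous (fun s => dsep o (c s) (v s))}.
  apply/subspace_continuousP => t; rewrite /= in_itv/= => tI.
  by apply: cvg_dsep; [exact: rc|exact: cc|exact: cv'].
have csep : {within `[t0, t1], continuous (fun s => sep o (c s))}.
  apply/subspace_continuousP => t; rewrite /= in_itv/= => tI.
  by apply: cvg_sep; exact: cc.
have ds t : t \in `]t0, t1[ ->
    is_derive t 1 (fun s => sep o (c s)) (dsep o (c t) (v t)).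
  rewrite in_itv/= => /andP[t0t tt1]; apply: is_derive_sep.
    by rewrite rc ?ltW.
  by move=> i j; apply: velocity_is_derive cv _; rewrite t0t.
have FTC : (\int[lebesgue_measure]_(x in `[t0, t1]) (dsep o (c x) (v x))%:E =
    (sep o (c t1))%:E - (sep o (c t0))%:E)%E.
  apply: (continuous_FTC2 (F := fun s => sep o (c s))) => //.
    have [_ ? ?] := (continuous_within_itvP _ t01).1 csep.
    by split => // t /ds[].
  by move=> t /ds tds; rewrite derive1E derive_val.
have ms := subspace_continuous_measurable_fun mI cs.
have md := subspace_continuous_measurable_fun mI cd.
rewrite -ge0_integralZl//; last 3 first.
- exact/measurable_EFinP.
- by move=> s _; rewrite lee_fin speed_ge0.
- by rewrite lee_fin addr_ge0// mulr_ge0.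
have -> : (`|sep o (c t1) - sep o (c t0)|%:E =
  `| \int[lebesgue_measure]_(x in `[t0, t1]) (dsep o (c x) (v x))%:E |)%E.
  by rewrite FTC -EFinB abse_EFin.
apply: le_trans (le_abse_integral _ _ _) _ => //; first exact/measurable_EFinP.
apply: ge0_le_integral => //.
- exact/measurableT_comp/measurable_EFinP.
- by apply/measurable_EFinP; apply: measurable_funM.
move=> s; rewrite /= in_itv/= => sI; rewrite -EFinM lee_fin.
by apply: dsep_le; apply: rc.
Qed.

End matrix_curves.

(** * Minkowski's integral inequality *)

Section integral_monotone.
Local Open Scope ereal_scope.
Import HBNNSimple.

(** The integral of a nonnegative function is a supremum over the simple
    functions below it, so monotonicity holds without measurability; the
    geodesic distance as a function of the point is not known to be
    measurable. *)
Lemma ge0_le_integral_any (R : realType) d (T : measurableType d)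
    (mu : {measure set T -> \bar R}) (D : set T) (f g : T -> \bar R) :
  (forall x, D x -> 0 <= f x) -> (forall x, D x -> f x <= g x) ->
  \int[mu]_(x in D) f x <= \int[mu]_(x in D) g x.
Proof.
move=> f0 fg; have g0 x : D x -> 0 <= g x.
  by move=> Dx; rewrite (le_trans (f0 x Dx)) ?fg.
rewrite !ge0_integralE//; apply: ereal_sup_le => _ [h hf <-].
exists h => // x.
by apply: le_trans (hf x) _; apply: lee_restrict.
Qed.

End integral_monotone.

Section integral_minkowski.
Local Open Scope ereal_scope.
Context (R : realType) d (T : measurableType d).
Variable mu : {sigma_finite_measure set T -> \bar R}.

Lemma measurable_sqrte d' (U : measurableType d') (f : U -> \bar R) :
  (forall x, 0 <= f x) -> measurable_fun setT f ->
  measurable_fun setT (fun x => sqrte (f x)).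
Proof.
move=> f0 mf; have -> : (fun x => sqrte (f x)) = (fun y => poweR y 2^-1) \o f.
  by apply/funext => x /=; rewrite poweR12_sqrt.
by apply: measurableT_comp => //; apply: measurable_poweR.
Qed.

Lemma mule_le_amgm (x y : \bar R) (l : R) : (0 < l)%R -> 0 <= x -> 0 <= y ->
  x * y <= (l / 2)%:E * x ^+ 2 + (l^-1 / 2)%:E * y ^+ 2.
Proof.
move=> l0; have l2 : (0 < l / 2)%R by rewrite divr_gt0.
have nNy (z : \bar R) : 0 <= z -> z != -oo by case: z.
have l3 : (0 < l^-1 / 2)%R by rewrite divr_gt0 ?invr_gt0.
case: x => [x||] // x0; case: y => [y||] // y0; last 3 first.
- rewrite [+oo ^+ 2]mulyy (gt0_muley (x := (l^-1 / 2)%:E)) ?lte_fin//.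
  by rewrite addey ?leey// nNy// mule_ge0 ?expe_ge0// lee_fin ltW.
- rewrite [+oo ^+ 2]mulyy (gt0_muley (x := (l / 2)%:E)) ?lte_fin//.
  by rewrite addye ?leey// nNy// mule_ge0 ?expe_ge0// lee_fin ltW.
- by rewrite [+oo ^+ 2]mulyy !gt0_muley ?lte_fin.
rewrite -!EFin_expe -!EFinM -EFinD lee_fin.
have -> : (l / 2 * x ^+ 2 + l^-1 / 2 * y ^+ 2 =
    x * y + l^-1 / 2 * (l * x - y) ^+ 2)%R by field; rewrite gt_eqF.
by rewrite lerDl mulr_ge0 ?sqr_ge0// ltW.
Qed.

Lemma integral_mul_eq0 (g h : T -> \bar R) :
  measurable_fun setT g -> measurable_fun setT h ->
  (forall x, 0 <= g x) -> (forall x, 0 <= h x) ->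
  \int[mu]_x (g x ^+ 2) = 0 -> \int[mu]_x (g x * h x) = 0.
Proof.
move=> mg mh g0 h0 g20.
have mg2 : measurable_fun setT (fun x => g x ^+ 2) by apply: emeasurable_funM.
rewrite (ge0_ae_eq_integral _ _ (g := cst 0)) ?integral0//.
- exact: emeasurable_funM.
- by move=> x _; rewrite mule_ge0.
have : ae_eq mu setT (fun x => g x ^+ 2) (cst 0).
  apply/(ae_eq_integral_abs mu measurableT mg2).
  by rewrite -[RHS]g20; apply: eq_integral => x _; rewrite gee0_abs// expe_ge0.
apply: filterS => x /(_ I) gx _; have : g x ^+ 2 == 0 by rewrite gx.
by rewrite expe_eq0/= => /eqP ->; rewrite mul0e.
Qed.

Section sum_of_spaces.
Variable K : nat.

(** The inner product of the L2 space of a disjoint union of [K] copies of the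
    measured space, one for each chart in the application. *)
Definition inner (g h : 'I_K -> T -> \bar R) : \bar R :=
  \sum_(k < K) \int[mu]_x (g k x * h k x).

Definition l2 g : \bar R := sqrte (inner g g).

Definition nonneg_measurable (g : 'I_K -> T -> \bar R) :=
  (forall k, measurable_fun setT (g k)) /\ (forall k x, 0 <= g k x).

Lemma inner_ge0 g h : nonneg_measurable g -> nonneg_measurable h ->
  0 <= inner g h.
Proof.
move=> [_ g0] [_ h0]; apply: sume_ge0 => k _; apply: integral_ge0 => x _.
by rewrite mule_ge0.
Qed.

Lemma innerC g h : inner g h = inner h g.
Proof.
by apply: eq_bigr => k _; apply: eq_integral => x _; rewrite muleC.
Qed.

Lemma inner_eq0 g h : nonneg_measurable g -> nonneg_measurable h ->
  inner g g = 0 -> inner g h = 0.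
Proof.
move=> [mg g0] [mh h0] /eqP; rewrite seq_psume_eq0 => [/allP gg0|k _]; last first.
  by apply: integral_ge0 => x _; rewrite mule_ge0.
rewrite /inner big1// => k _; apply: integral_mul_eq0 => //.
by apply/eqP; apply: (gg0 k); rewrite mem_index_enum.
Qed.

(** Cauchy-Schwarz, by integrating the weighted inequality of arithmetic and
    geometric means. A function of norm zero is treated apart, because the other
    norm may then be infinite. *)
Lemma inner_le_l2 g h : nonneg_measurable g -> nonneg_measurable h ->
  inner g h <= l2 g * l2 h.
Proof.
move=> ng nh; have [a0|aN0] := eqVneq (inner g g) 0.
  by rewrite inner_eq0// mule_ge0// sqrte_ge0.
have [b0|bN0] := eqVneq (inner h h) 0.
  by rewrite innerC inner_eq0// mule_ge0// sqrte_ge0.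
have a0 : 0 < inner g g by rewrite lt0e aN0 inner_ge0.
have b0 : 0 < inner h h by rewrite lt0e bN0 inner_ge0.
have gt0_sqrte (x : \bar R) : 0 < x -> 0 < sqrte x.
  by case: x => // x; rewrite !lte_fin sqrtr_gt0.
rewrite /l2; have [aoo|aoo] := eqVneq (inner g g) +oo.
  by rewrite aoo/= gt0_mulye ?leey ?gt0_sqrte.
have [boo|boo] := eqVneq (inner h h) +oo.
  by rewrite boo/= gt0_muley ?leey ?gt0_sqrte.
have fin (x : \bar R) : 0 < x -> x != +oo -> exists2 p, (0 < p)%R & x = p%:E.
  by case: x => // p p0 _; exists p.
have [p p0 gg] := fin _ a0 aoo; have [q q0 hh] := fin _ b0 boo.
pose r := Num.sqrt p; pose s := Num.sqrt q.
(* the ratio of the norms is the optimal weight *)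
have r0 : (0 < r)%R by rewrite sqrtr_gt0.
have s0 : (0 < s)%R by rewrite sqrtr_gt0.
have l0 : (0 < s / r)%R by rewrite divr_gt0.
apply: (@le_trans _ _
    ((s / r / 2)%:E * inner g g + ((s / r)^-1 / 2)%:E * inner h h)).
  case: ng nh => mg g0 [mh h0].
  rewrite !ge0_sume_distrr; last 2 first.
  - by move=> k _; apply: integral_ge0 => x _; rewrite mule_ge0.
  - by move=> k _; apply: integral_ge0 => x _; rewrite mule_ge0.
  rewrite -big_split/=; apply: lee_sum => k _.
  have mM (u v : T -> \bar R) : measurable_fun setT u -> measurable_fun setT v ->
    measurable_fun setT (fun x => u x * v x) by move=> *; apply: emeasurable_funM.
  rewrite -!ge0_integralZl//; do ?[exact: mM|by move=> x _; rewrite mule_ge0].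
  - rewrite -ge0_integralD//.
    + apply: ge0_le_integral_any => x _; first by rewrite mule_ge0.
      by rewrite -!expe2; apply: mule_le_amgm.
    + by move=> x _; rewrite !mule_ge0// lee_fin ltW// divr_gt0.
    + by apply: (mM (cst _)) => //; exact: mM.
    + by move=> x _; rewrite !mule_ge0// lee_fin ltW// divr_gt0// invr_gt0.
    + by apply: (mM (cst _)) => //; exact: mM.
  - by rewrite lee_fin ltW// divr_gt0// invr_gt0.
  - by rewrite lee_fin ltW// divr_gt0.
rewrite gg hh /= -!EFinM -EFinD lee_fin -/r -/s.
have -> : p = (r ^+ 2)%R by rewrite sqr_sqrtr// ltW.
have -> : q = (s ^+ 2)%R by rewrite sqr_sqrtr// ltW.
rewrite le_eqVlt; apply/orP; left; apply/eqP.
by field; rewrite !gt_eqF.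
Qed.

Section family.
Context d' (S : measurableType d').
Variable nu : {sigma_finite_measure set S -> \bar R}.
Variables (N : nat) (f : 'I_N -> 'I_K -> S * T -> \bar R).
Hypotheses (mf : forall j k, measurable_fun setT (f j k))
  (f0 : forall j k p, 0 <= f j k p).

Definition slice j s k x := f j k (s, x).

Definition total k x := \sum_(j < N) \int[nu]_s f j k (s, x).

Lemma nonneg_measurable_slice j s : nonneg_measurable (slice j s).
Proof.
split=> [k|k x]; last exact: f0.
exact: measurableT_comp (mf j k) (pair1_measurable s).
Qed.

Lemma nonneg_measurable_total : nonneg_measurable total.
Proof.
split=> [k|k x]; last by apply: sume_ge0 => j _; apply: integral_ge0.
apply: emeasurable_sum => j.
exact: (measurable_fun_fubini_tonelli_G (m1 := nu) (f j k)).
Qed.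

Section tonelli.
Variables (g : 'I_K -> T -> \bar R) (ng : nonneg_measurable g).

Let mgf j k : measurable_fun setT (fun p : S * T => g k p.2 * f j k p).
Proof.
apply: emeasurable_funM => //.
by apply: measurableT_comp measurable_snd; case: ng.
Qed.

Let gf0 j k p : 0 <= g k p.2 * f j k p.
Proof. by rewrite mule_ge0//; case: ng. Qed.

(** Tonelli's theorem on each copy. *)
Lemma inner_total :
  inner g total = \sum_(j < N) \int[nu]_s inner g (slice j s).
Proof.
transitivity (\sum_(k < K) \sum_(j < N)
    \int[nu]_s \int[mu]_x (g k x * f j k (s, x))).
  apply: eq_bigr => k _.
  transitivity (\int[mu]_x \sum_(j < N) \int[nu]_s (g k x * f j k (s, x))).
    apply: eq_integral => x _; rewrite ge0_sume_distrr; last first.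
      by move=> j _; apply: integral_ge0.
    apply: eq_bigr => j _; rewrite ge0_integralZl//; last by case: ng.
    exact: measurableT_comp (mf j k) (pair2_measurable x).
  rewrite ge0_integral_sum//; last 2 first.
  - move=> j.
    exact: (measurable_fun_fubini_tonelli_G (m1 := nu) _ (mgf j k) (gf0 j k)).
  - by move=> j x _; apply: integral_ge0 => s _; apply: (gf0 j k (s, x)).
  apply: eq_bigr => j _.
  by rewrite (fubini_tonelli (m1 := nu) (m2 := mu) _ (mgf j k) (gf0 j k)).
rewrite exchange_big; apply: eq_bigr => j _; rewrite /= -ge0_integral_sum//.
- move=> k.
  exact: (measurable_fun_fubini_tonelli_F (m2 := mu) _ (mgf j k) (gf0 j k)).
- by move=> k s _; apply: integral_ge0 => x _; apply: (gf0 j k (s, x)).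
Qed.

End tonelli.

Lemma measurable_l2_slice j : measurable_fun setT (fun s => l2 (slice j s)).
Proof.
apply: measurable_sqrte => [s|].
  by apply: inner_ge0; apply: nonneg_measurable_slice.
apply: emeasurable_sum => k.
apply: (measurable_fun_fubini_tonelli_F (m2 := mu) (fun p => f j k p * f j k p)).
- exact: emeasurable_funM.
- by move=> p; rewrite mule_ge0.
Qed.

Let B := \sum_(j < N) \int[nu]_s l2 (slice j s).

(** By Cauchy-Schwarz on each slice. *)
Lemma inner_total_le g : nonneg_measurable g -> inner g total <= l2 g * B.
Proof.
move=> ng; rewrite inner_total// /B ge0_sume_distrr; last first.
  by move=> j _; apply: integral_ge0 => s _; apply: sqrte_ge0.
apply: lee_sum => j _; rewrite -ge0_integralZl//; last 3 first.
- exact: measurable_l2_slice.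
- by move=> s _; apply: sqrte_ge0.
- exact: sqrte_ge0.
apply: ge0_le_integral_any => s _.
  by apply: inner_ge0 => //; apply: nonneg_measurable_slice.
by apply: inner_le_l2 => //; apply: nonneg_measurable_slice.
Qed.

(** Applied first to the slices and then to the total itself, the previous
    bound gives Minkowski's inequality without dividing by [l2 total], which
    may be infinite. *)
Lemma minkowski_integral : inner total total <= B ^+ 2.
Proof.
have B0 : 0 <= B.
  by apply: sume_ge0 => j _; apply: integral_ge0 => s _; apply: sqrte_ge0.
have nt := nonneg_measurable_total.
rewrite [leLHS]inner_total// expe2 {1}/B ge0_sume_distrl; last first.
  by move=> j _; apply: integral_ge0 => s _; apply: sqrte_ge0.
apply: lee_sum => j _; rewrite -ge0_integralZr//; last 2 first.
- exact: measurable_l2_slice.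
- by move=> s _; apply: sqrte_ge0.
apply: ge0_le_integral_any => s _.
  by apply: inner_ge0 => //; apply: nonneg_measurable_slice.
rewrite innerC; apply: inner_total_le; exact: nonneg_measurable_slice.
Qed.

End family.

End sum_of_spaces.

End integral_minkowski.

(** * Measurability *)

(** The sigma-algebra on tuples is the product one, whereas continuity refers to
    the topology of row vectors. *)
Section measurability_in_rows.
Context (R : realType) (m : nat).
Local Notation row_of_tuple := (@row_of_tuple R m).
Implicit Types (O V : set 'rV[R]_m) (Y : set (m.-tuple (measurableTypeR R))).

Lemma measurable_row_box (A : 'I_m -> set R) :
  (forall b, measurable (A b : set (measurableTypeR R))) ->
  measurable (row_of_tuple @^-1` [set y | forall b, A b (y 0 b)]).
Proof.
move=> mA.
have -> : row_of_tuple @^-1` [set y | forall b, A b (y 0 b)] =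
    \bigcap_(b in setT)
      ((fun z : m.-tuple (measurableTypeR R) => tnth z b) @^-1` A b).
  by apply/seteqP; split=> z /= zA b; [move=> _|];
     have := zA b; rewrite /= mxE => //; apply.
apply: fin_bigcap_measurable => // b _; rewrite -[X in measurable X]setTI.
exact: measurable_tnth.
Qed.

(** An open set is a countable union of balls with rational data. *)
Lemma measurable_open_row O : open O -> measurable (row_of_tuple @^-1` O).
Proof.
move=> oO.
pose box (p : 'rV[rat]_m * nat) : set 'rV[R]_m :=
  [set y | forall b, `|y 0 b - ratr (p.1 0 b)| < p.2.+1%:R^-1].
pose B p : set (m.-tuple (measurableTypeR R)) :=
  if `[< box p `<=` O >] then row_of_tuple @^-1` box p else set0.
have -> : row_of_tuple @^-1` O = \bigcup_p B p.
  apply/seteqP; split=> [z /= Oz|z [p _]]; last first.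
    by rewrite /B; case: asboolP => // pO; apply: pO.
  have [e /= e0 eO] := (nbhs_ballP _ _).1 (open_nbhs_nbhs (conj oO Oz)).
  have [k] := ltr_add_invr (divr_gt0 e0 (ltr0n R 2)); rewrite add0r => ke.
  pose h : R := k.+1%:R^-1; have h0 : 0 < h by rewrite invr_gt0.
  have /choice[q qz] : forall b, exists r : rat, `|tnth z b - ratr r| < h.
    move=> b; have [|r] := @rat_in_itvoo R (tnth z b - h) (tnth z b + h).
      by rewrite ltrD2l gtrN.
    by rewrite in_itv/= => /andP[r1 r2]; exists r; rewrite ltr_norml; lra.
  exists (\row_b q b, k) => //; rewrite /B; case: asboolP => [_|[]] /=.
    by move=> b; rewrite !mxE.
  move=> y yq; apply: eO; split=> [//|i j]; rewrite ord1 /ball /= !mxE.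
  have := yq j; rewrite !mxE /= -/h => yqj.
  apply: le_lt_trans (ler_distD (ratr (q j)) _ _) _.
  rewrite (splitr e) ltrD//; first exact: lt_trans (qz j) _.
  by rewrite distrC; apply: lt_trans yqj _.
apply: countable_bigcupT_measurable => // p; rewrite /B; case: ifP => // _.
apply: (measurable_row_box
  (A := fun b => [set x | `|x - ratr (p.1 0 b)| < p.2.+1%:R^-1])).
move=> b; apply: open_measurable.
have -> : [set x : R | `|x - ratr (p.1 0 b)| < p.2.+1%:R^-1] =
    ball (ratr (p.1 0 b) : R) p.2.+1%:R^-1.
  by apply/seteqP; split=> x; rewrite /ball /= distrC.
exact: ball_open.
Qed.

Lemma measurable_half_space : measurable (row_of_tuple @^-1` @half_space R m).
Proof.
apply: (measurable_row_box
  (A := fun b => [set x | b = 0%N :> nat -> 0 <= x])) => b.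
have [->|b0] := eqVneq (b : nat) 0%N.
  have -> : [set x : R | 0%N = 0%N -> 0 <= x] = `[0, +oo[%classic.
    by apply/seteqP; split=> x /=; rewrite in_itv/= andbT; [apply|].
  exact: measurable_itv.
have -> : [set x : R | b = 0%N :> nat -> 0 <= x] = setT; last exact: measurableT.
by apply/seteqP; split=> // x _ /= /eqP; rewrite (negPf b0).
Qed.

Lemma measurable_open_in_half_space V :
  open_in_half_space V -> measurable (row_of_tuple @^-1` V).
Proof.
move=> [U oU ->]; rewrite preimage_setI; apply: measurableI.
  exact: measurable_open_row.
exact: measurable_half_space.
Qed.

(** Continuity relative to [V] suffices, as the preimage of an open set is the
    trace on [V] of an open set. *)
Lemma measurable_continuous_row V Y (phi : 'rV[R]_m -> R) :
  measurable Y -> Y `<=` row_of_tuple @^-1` V -> {within V, continuous phi} ->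
  measurable_fun Y (phi \o row_of_tuple).
Proof.
move=> mY YV cphi; apply: (measurability _ (RGenOInfty.measurableE R)).
move=> _ [_ [a ->] <-].
have /continuousP/(_ _ (@open_gt R a))/open_subspaceP[U oU UV] := cphi.
have -> : Y `&` (phi \o row_of_tuple) @^-1` `]a, +oo[ =
    Y `&` row_of_tuple @^-1` U.
  apply/seteqP; split=> z [Yz] /= Hz; split=> //.
    have : (U `&` V) (row_of_tuple z); last by case.
    by rewrite UV; split; [move: Hz; rewrite in_itv/= andbT|exact: YV].
  have : (phi @^-1` [set x | a < x] `&` V) (row_of_tuple z).
    by rewrite -UV; split=> //; exact: YV.
  by rewrite in_itv/= andbT => -[].
by apply: measurableI => //; apply: measurable_open_row.
Qed.

End measurability_in_rows.

(** A function which is measurable in [z] and continuous in [s] is the limit of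
    its values at the points of finer and finer grids in [s]. *)
Lemma measurable_caratheodory (R : realType) d (Z : measurableType d)
    (D : set Z) (t0 t1 : R) (f : R -> Z -> R) :
  measurable D ->
  (forall s, t0 <= s <= t1 -> measurable_fun D (f s)) ->
  (forall z, D z -> {within `[t0, t1], continuous (f ^~ z)}) ->
  measurable_fun ((`[t0, t1] : set (measurableTypeR R)) `*` D)
    (fun p => f p.1 p.2).
Proof.
move=> mD mf cf.
pose grid n k : R := t0 + k%:R / n.+1%:R.
pose h n (p : measurableTypeR R * Z) : R :=
  f (grid n (Num.truncn ((p.1 - t0) * n.+1%:R))) p.2.
have truncE n k s : grid n k <= s < grid n k.+1 ->
    Num.truncn ((s - t0) * n.+1%:R) = k.
  rewrite /grid -lerBrDl -ltrBlDl ler_pdivrMr// ltr_pdivlMr//.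
  exact: truncn_def.
have gridP n s : t0 <= s ->
    let k := Num.truncn ((s - t0) * n.+1%:R) in grid n k <= s < grid n k.+1.
  move=> ts /=; rewrite /grid -lerBrDl -ltrBlDl ler_pdivrMr// ltr_pdivlMr//.
  by apply: truncn_itv; rewrite mulr_ge0// subr_ge0.
have grid_ge n k : t0 <= grid n k by rewrite lerDl.
apply: (measurable_fun_cvg (h := h)) => [n|[s z] [/= sI Dz]].
  pose E k :=
    (`[t0, t1] `&` `[grid n k, grid n k.+1[ : set (measurableTypeR R)) `*` D.
  have mE k : measurable (E k).
    by apply: measurableX => //; apply: measurableI.
  have -> : (`[t0, t1] : set (measurableTypeR R)) `*` D = \bigcup_k E k.
    apply/seteqP; split=> [[s z] [/= sI Dz]|p [k _] [[? _] ?]//].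
    exists (Num.truncn ((s - t0) * n.+1%:R)) => //; split=> //; split=> //=.
    by rewrite in_itv/=; apply: gridP; move: sI; rewrite in_itv => /andP[].
  apply/(measurable_fun_bigcup _ mE) => k.
  (* [f] is only known to be measurable at grid points inside [t0, t1] *)
  have [kt1|t1k] := leP (grid n k) t1; last first.
    have -> : E k = set0; last exact: measurable_fun_set0.
    apply/seteqP; split=> // -[s z] [[/= sI skI] _].
    move: sI skI; rewrite !in_itv/= => /andP[_ st1] /andP[ks _].
    by move: (le_lt_trans st1 t1k); rewrite ltNge ks.
  apply: (eq_measurable_fun (f (grid n k) \o snd)) => [[s z]|].
    rewrite inE => -[[_ /=]]; rewrite in_itv/= => skI _.
    by rewrite /h /= (truncE _ _ _ skI).
  apply: (@measurable_comp _ _ _ _ _ _ D) => //.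
  - by move=> _ [p [_ Dp] <-].
  - by apply: mf; rewrite grid_ge.
  - exact: measurable_funTS measurable_snd.
have /subspace_continuousP/(_ s sI) := cf z Dz.
move: sI; rewrite in_itv/= => /andP[t0s st1].
apply: cvg_comp; move=> A [e /= e0 eA].
have [N _ Ne] := near_infty_natSinv_lt (PosNum e0).
exists N => // n /= Nn; have /andP[gs sg] := gridP n s t0s.
apply: eA => /=; last by rewrite in_itv/= grid_ge/= (le_trans gs).
rewrite ger0_norm ?subr_ge0//; apply: lt_trans (Ne n Nn).
by move: sg; rewrite /grid -natr1 mulrDl addrA mul1r ltrBlDl.
Qed.

Lemma lebesgue_measure_box_gt0 (R : realType) (m : nat) (a : 'I_m -> R) (e : R) :
  0 < e -> (0 < lebesgue_measure_tuple R m
    [set z | forall b, (a b < tnth z b < a b + e)%R])%E.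
Proof.
move=> e0; elim: m a => [|m IH] a.
  by rewrite /= diracE mem_set//= => -[].
rewrite /= /measure_cons /pushforward.
set A := [set z | _]; pose A' := [set z : m.-tuple (measurableTypeR R) |
  forall b, (a (lift ord0 b) < tnth z b < a (lift ord0 b) + e)%R].
have -> : @tuple_cons _ (measurableTypeR R) m @^-1` A =
    `]a ord0, (a ord0 + e)%R[ `*` A'.
  apply/seteqP; split=> -[s z] /=.
    move=> Asz; split; first by have := Asz ord0; rewrite /= tnth0 in_itv.
    by move=> b; have := Asz (lift ord0 b); rewrite tnthS.
  rewrite in_itv/= => -[s0 zA] b; have [j ->|->] := unliftP ord0 b.
    by rewrite tnthS.
  by rewrite tnth0.
have mA' : measurable A'.
  have -> : A' = @row_of_tuple R m @^-1`
      [set y | forall b, `]a (lift ord0 b), a (lift ord0 b) + e[%classic (y 0 b)].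
    by apply/seteqP; split=> z /= zA b; have := zA b; rewrite /= mxE in_itv.
  apply: (measurable_row_box
    (A := fun b => `]a (lift ord0 b), a (lift ord0 b) + e[%classic)) => b.
  exact: measurable_itv.
rewrite product_measure1E//; apply: mule_gt0; last exact: IH.
have := lebesgue_measure_itv `]a ord0, (a ord0 + e)%R[; rewrite /= lte_fin.
rewrite ltrDl e0 -EFinB addrAC subrr add0r => ae.
suff : (0 < lebesgue_measure (`]a ord0, (a ord0 + e)%R[%classic : set R))%E by [].
by rewrite ae lte_fin.
Qed.

Section pieces.
Context (R : realType) (m : nat) (M : compact_manifold R m).
Implicit Types k l : 'I_(size (chart_cover M)).

Definition cover_chart k : chart M := tnth (in_tuple (chart_cover M)) k.

Definition coord_image (i : chart M) : set 'rV[R]_m :=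
  chart_coord i @` chart_dom i.

Definition piece_rows k : set (m.-tuple (measurableTypeR R)) :=
  @row_of_tuple R m @^-1` (chart_coord (cover_chart k) @` piece (M := M) k).

Lemma coord_imageP i y : coord_image i y ->
  chart_dom i (chart_param i y) /\ chart_coord i (chart_param i y) = y.
Proof. by move=> [x ix <-]; rewrite chart_paramK. Qed.

Lemma piece_dom k x : piece k x -> chart_dom (cover_chart k) x.
Proof. by case. Qed.

Lemma piece_rows_image k :
  piece_rows k `<=` @row_of_tuple R m @^-1` coord_image (cover_chart k).
Proof. by move=> z [x /piece_dom kx xz]; exists x. Qed.

(** The image of a piece is a relatively open subset of the half-space minus
    the traces of finitely many open sets. *)
Lemma measurable_piece_rows k : measurable (piece_rows k).
Proof.
set i := cover_chart k.
have /choice[U UP] l : exists U : set 'rV[R]_m, open U /\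
    U `&` coord_image i =
      chart_param i @^-1` chart_dom (cover_chart l) `&` coord_image i.
  have /continuousP/(_ _ (chart_dom_open (cover_chart l))) :=
    @chart_param_continuous _ _ M i.
  by move=> /open_subspaceP[U oU UE]; exists U.
have -> : piece_rows k = @row_of_tuple R m @^-1` coord_image i `\`
    \bigcup_(l in [set l : 'I__ | (l < k)%N]) (@row_of_tuple R m @^-1` U l).
  apply/seteqP; split=> z /=.
    move=> [x [ix xk] xz]; split; first by exists x.
    move=> [l /= lk Uz]; apply: xk; exists l => //.
    have : (U l `&` coord_image i) (chart_coord i x).
      by split; [rewrite xz|exists x].
    by rewrite (UP l).2 => -[/=]; rewrite chart_paramK.
  move=> [[x ix xz] zU]; exists x => //; split=> // -[l /= lk lx].
  apply: zU; exists l => //=.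
  have : (chart_param i @^-1` chart_dom (cover_chart l) `&` coord_image i)
      (chart_coord i x).
    by split; [rewrite /= chart_paramK|exists x].
  by rewrite -(UP l).2 xz => -[].
apply: measurableD.
  by apply: measurable_open_in_half_space; apply: chart_coord_open.
apply: fin_bigcup_measurable => // l _.
by apply: measurable_open_row; case: (UP l).
Qed.

End pieces.

(** * Curves of one-forms *)

Section curves_of_forms.
Context (R : realType) (m n : nat) (M : compact_manifold R m).
Local Notation form := (chart M -> M -> 'M[R]_(n, m)).
Implicit Types (z : form) (c v w : R -> form) (i : chart M) (x : M).

Lemma one_form_inj_rank z i x : one_form_inj z -> chart_dom i x ->
  \rank (z i x) = m.
Proof. by move=> [_ zinj] ix; apply: full_rank_inj; apply: zinj. Qed.

(** The seminorm for the compact set consisting of the coordinates of [x] and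
    no derivative is the size of the value at [x]. *)
Lemma form_velocity_at t0 t1 c v i x : chart_dom i x ->
  has_velocity (@form_ball R m n M) t0 t1 c v ->
  has_velocity (@matrix_ball R n m) t0 t1 (fun s => c s i x) (fun s => v s i x).
Proof.
move=> ix cv t tI k e e0.
have := cv t tI (i, [set chart_coord i x], [::]) e e0.
apply: filterS => s /(_ (@compact_set1 _ _)) [].
  by move=> _ ->; exists x.
move=> e' e'e H a b; have := H (chart_coord i x) a b erefl.
by rewrite /= chart_paramK// => /le_lt_trans; apply.
Qed.

Lemma form_continuous_in_chart i a b z : one_form z ->
  {within coord_image i, continuous (fun y => z i (chart_param i y) a b)}.
Proof. by move=> zf; have [] := one_form_smooth zf i a b [::]. Qed.

Lemma continuous_speed_in_chart z z' i :
  one_form_inj z -> one_form z' ->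
  {within coord_image i, continuous
    (fun y => speed (z i (chart_param i y)) (z' i (chart_param i y)))}.
Proof.
move=> zinj z'f; apply/subspace_continuousP => y iy.
have [iy' _] := coord_imageP iy.
apply: cvg_speed; first exact: one_form_inj_rank.
- move=> a b; have cz := @form_continuous_in_chart i a b z zinj.1.
  exact: (subspace_continuousP _ _).1 cz y iy.
- move=> a b; have cz := @form_continuous_in_chart i a b z' z'f.
  exact: (subspace_continuousP _ _).1 cz y iy.
Qed.

Section path.
Variables (c : R -> form) (N : nat) (t : nat -> R) (v : nat -> R -> form).
Hypotheses (cinj : forall s, 0 <= s <= 1 -> one_form_inj (c s))
  (t0 : t 0%N = 0) (tN : t N = 1)
  (smooth : forall j, (j < N)%N -> t j < t j.+1 /\
     smooth_curve (@one_form R m n M) (@form_ball R m n M) (t j) (t j.+1) c (v j)).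

Lemma subdivision_itv j s : (j < N)%N -> t j <= s <= t j.+1 -> 0 <= s <= 1.
Proof.
have tle (j1 j2 : nat) : (j1 <= j2 <= N)%N -> t j1 <= t j2.
  move=> /andP[j12 j2N]; elim: j2 j12 j2N => [|j2 IH].
    by rewrite leqn0 => /eqP ->.
  rewrite leq_eqVlt => /predU1P[->//|j12 j2N].
  by rewrite (le_trans (IH j12 (ltnW j2N)))// ltW; case: (smooth j2N).
move=> jN /andP[js sj].
have tj0 : t 0%N <= t j by apply: tle; rewrite leq0n ltnW.
have tj1 : t j.+1 <= t N by apply: tle; rewrite jN leqnn.
by rewrite t0 in tj0; rewrite tN in tj1; rewrite (le_trans tj0 js) (le_trans sj).
Qed.

Section at_point.
Variables (i : chart M) (x : M).
Hypothesis ix : chart_dom i x.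

Let ci s := c s i x.
Let vi j s := v j s i x.

Lemma path_smooth_at j : (j < N)%N -> exists d : nat -> R -> 'M[R]_(n, m),
  [/\ d 0%N = ci, d 1%N = vi j & forall l,
    has_velocity (@matrix_ball R n m) (t j) (t j.+1) (d l) (d l.+1)].
Proof.
move=> jN; have [_ [d [d0 d1 dl]]] := smooth jN.
exists (fun l s => d l s i x); split=> [||l]; first by rewrite d0.
  by rewrite d1.
by apply: form_velocity_at => //; case: (dl l).
Qed.

Lemma path_rank s : 0 <= s <= 1 -> \rank (ci s) = m.
Proof. by move=> sI; apply: one_form_inj_rank => //; apply: cinj. Qed.

Lemma path_speed_continuous j : (j < N)%N ->
  {within `[t j, t j.+1], continuous (fun s => speed (ci s) (vi j s))}.
Proof.
move=> jN; have [d [d0 d1 dl]] := path_smooth_at jN.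
apply/subspace_continuousP => s; rewrite /= in_itv/= => sI.
apply: cvg_speed.
- by apply: path_rank; apply: subdivision_itv sI.
- by have := velocity_continuous (dl 0%N) sI; rewrite d0.
- by have := velocity_continuous (dl 1%N) sI; rewrite d1.
Qed.

Lemma path_speed_measurable j : (j < N)%N ->
  measurable_fun (`[t j, t j.+1] : set (measurableTypeR R))
    (fun s => (speed (ci s) (vi j s))%:E).
Proof.
move=> jN; apply/measurable_EFinP; apply: subspace_continuous_measurable_fun => //.
exact: path_speed_continuous.
Qed.

End at_point.

Definition point_length (i : chart M) (x : M) : \bar R :=
  (\sum_(j < N) \int[lebesgue_measure]_(s in `[t j, t j.+1])
     (speed (c s i x) (v j s i x))%:E)%E.

Lemma point_length_ge0 i x : (0 <= point_length i x)%E.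
Proof.
apply: sume_ge0 => j _; apply: integral_ge0 => s _.
by rewrite lee_fin speed_ge0.
Qed.

Lemma sep_le_point_length i x o : chart_dom i x ->
  (`|sep o (c 1 i x) - sep o (c 0 i x)|%:E <=
     (sep_bound R n)%:E * point_length i x)%E.
Proof.
move=> ix; rewrite -tN -t0 -(telescope_sumr (fun j => sep o (c (t j) i x)))//.
rewrite big_mkord ge0_sume_distrr; last first.
  by move=> j _; apply: integral_ge0 => s _; rewrite lee_fin speed_ge0.
apply: (@le_trans _ _ (\sum_(j < N)
    `|sep o (c (t j.+1) i x) - sep o (c (t j) i x)|%:E)%E).
  by rewrite sumEFin lee_fin ler_norm_sum.
apply: lee_sum => j _; have [d [d0 d1 dl]] := path_smooth_at ix (ltn_ord j).
have := @sep_le_length R n m (t j) (t j.+1) (d 0%N) (d 1%N) (d 2) o.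
rewrite d0 d1; apply.
- by case: (smooth (ltn_ord j)).
- by rewrite -d0 -d1; apply: dl.
- by rewrite -d1; apply: dl.
by move=> s sI; apply: path_rank => //; apply: subdivision_itv sI.
Qed.

(** The metric is multiplied by [|det b|] when the matrices are expressed in
    another basis, so that the path at [x] expressed in the basis [b] has the
    length on the right. *)
Lemma matrix_dist_le_point_length i x (b : 'M[R]_m) : chart_dom i x ->
  b \in unitmx ->
  (matrix_dist (c 0 i x *m b) (c 1 i x *m b) <=
     (Num.sqrt `|\det b|)%:E * point_length i x)%E.
Proof.
move=> ix ub; apply: ereal_inf_lbound.
exists (fun s => c s i x *m b), N, t, (fun j s => v j s i x *m b); split=> //.
- move=> s sI; rewrite /full_rank /= mxrankMfree ?row_free_unit//.
  exact: path_rank.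
- move=> j jN; split; first by case: (smooth jN).
  have [d [d0 d1 dl]] := path_smooth_at ix jN.
  exists (fun l s => d l s *m b); split.
  + by rewrite d0.
  + by rewrite d1.
  move=> l; split=> // s sI k e e0.
  have [K K0 bK] : exists2 K, 0 < K & forall q r, `|b q r| <= K.
    exists (1 + norm2 b) => [|q r]; first exact: N1_gt0.
    exact: le_entry_N1.
  have mK : 0 < m%:R * K + 1 by rewrite ltr_wpDl// mulr_ge0// ltW.
  have := dl l s sI tt (e / (m%:R * K + 1)) (divr_gt0 e0 mK).
  apply: filterS => s' H p r; rewrite -mulmxBl scalemxAl -mulmxBl mxE.
  apply: (@le_lt_trans _ _ (\sum_(q < m) e / (m%:R * K + 1) * K)).
    apply: le_trans (ler_norm_sum _ _ _) _; apply: ler_sum => q _.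
    by rewrite normrM; apply: ler_pM => //; apply/ltW/H.
  rewrite sumr_const card_ord -[X in X < _]mulr_natl.
  have -> : m%:R * (e / (m%:R * K + 1) * K) = e * (m%:R * K) / (m%:R * K + 1).
    by field; rewrite gt_eqF.
  by rewrite ltr_pdivrMr// ltr_pM2l// ltrDl.
rewrite ge0_sume_distrr; last first.
  by move=> j _; apply: integral_ge0 => s _; rewrite lee_fin speed_ge0.
apply: eq_bigr => j _; rewrite -ge0_integralZl//; last 2 first.
- by have := path_speed_measurable ix (ltn_ord j); apply.
- by move=> s _; rewrite lee_fin speed_ge0.
apply: eq_integral => s; rewrite inE/= in_itv/= => sI.
have rc : \rank (c s i x) = m.
  by apply: path_rank => //; apply: subdivision_itv sI.
by rewrite matrix_metric_mulmx// sqrtrM// -EFinM -speedE.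
Qed.

End path.
End curves_of_forms.

(** * Paths of one-forms and the paths of matrices they trace *)

Section lengths_of_paths_of_forms.
Context (R : realType) (m n : nat) (M : compact_manifold R m).
Local Notation form := (chart M -> M -> 'M[R]_(n, m)).
Variables (c : R -> form) (N : nat) (t : nat -> R) (v : nat -> R -> form).
Hypotheses (cinj : forall s, 0 <= s <= 1 -> one_form_inj (c s))
  (t0 : t 0%N = 0) (tN : t N = 1)
  (smooth : forall j, (j < N)%N -> t j < t j.+1 /\
     smooth_curve (@one_form R m n M) (@form_ball R m n M) (t j) (t j.+1)
       c (v j)).

Local Notation K := (size (chart_cover M)).
Local Notation rows := (m.-tuple (measurableTypeR R)).

Let pt (k : 'I_K) (z : rows) : M := chart_param (cover_chart k) (row_of_tuple z).

Let dom_pt k z : piece_rows k z -> chart_dom (cover_chart k) (pt k z).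
Proof. by move=> /piece_rows_image/coord_imageP[]. Qed.

Let f (j : 'I_N) (k : 'I_K) : measurableTypeR R * rows -> \bar R :=
  (fun p => (speed (c p.1 (cover_chart k) (pt k p.2))
                   (v j p.1 (cover_chart k) (pt k p.2)))%:E)
  \_ ((`[t j, t j.+1] : set (measurableTypeR R)) `*` piece_rows k).

Let f0 j k p : (0 <= f j k p)%E.
Proof. by rewrite /f patchE; case: ifP => // _; rewrite lee_fin speed_ge0. Qed.

Let mf j k : measurable_fun setT (f j k).
Proof.
have mP := @measurable_piece_rows _ _ M k.
apply/(measurable_restrictT _ _).1; first exact: measurableX.
apply/measurable_EFinP.
apply: (measurable_caratheodory (f := fun s z =>
  speed (c s (cover_chart k) (pt k z)) (v j s (cover_chart k) (pt k z)))) => //.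
  move=> s sI; pose i := cover_chart k.
  apply: (@measurable_continuous_row _ _ (coord_image i) _
    (fun y => speed (c s i (chart_param i y)) (v j s i (chart_param i y)))) => //.
  - exact: piece_rows_image.
  apply: continuous_speed_in_chart.
    by apply: cinj; apply: subdivision_itv t0 tN smooth _ _ (ltn_ord j) sI.
  have [_ [d [_ d1 /(_ 1%N)[d1f _]]]] := smooth (ltn_ord j).
  by rewrite -d1; apply: d1f.
move=> z kz.
exact: (path_speed_continuous cinj t0 tN smooth (dom_pt kz) (ltn_ord j)).
Qed.

Let total_f k z : total lebesgue_measure f k z =
  ((fun z => point_length c N t v (cover_chart k) (pt k z)) \_ (piece_rows k)) z.
Proof.
rewrite patchE /total; case: ifPn => kz.
  apply: eq_bigr => j _; rewrite [RHS]integral_mkcond.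
  have <- : (fun s => f j k (s, z)) = ((fun s => (speed (c s (cover_chart k)
      (pt k z)) (v j s (cover_chart k) (pt k z)))%:E) \_ `[t j, t j.+1]).
    apply/funext => s.
    rewrite /f !patchE; case: (boolP (s \in _)) => [sI|/negP sI].
      by rewrite ifT// inE; split; apply/set_mem.
    by rewrite ifN//; apply/negP => /set_mem[/mem_set].
  by [].
rewrite big1// => j _; apply: integral0_eq => s _.
by rewrite /f patchE ifN//; apply/negP => /set_mem[_ /mem_set]; apply/negP.
Qed.

Let l2_slice (j : 'I_N) s : l2 (lebesgue_measure_tuple R m) (slice f j s) =
  ((fun s => sqrte (ebin_metric (c s) (v j s) (v j s))) \_ `[t j, t j.+1]) s.
Proof.
rewrite patchE /l2 /inner; case: ifPn => sI; last first.
  rewrite big1 ?sqrte0// => k _; apply: integral0_eq => z _.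
  rewrite /slice /f patchE ifN ?mul0e//; apply/negP => /set_mem[/mem_set sI' _].
  by rewrite sI' in sI.
congr sqrte; apply: eq_bigr => k _; rewrite /row_integral -/(piece_rows k).
rewrite [RHS]integral_mkcond; apply: eq_integral => z _; rewrite /slice /f !patchE.
case: (boolP (z \in _)) => [kz|/negP kz]; last first.
  by rewrite ifN ?mul0e//; apply/negP => /set_mem[_ /mem_set].
rewrite ifT; last by rewrite inE; split; apply/set_mem.
rewrite -EFinM; congr (_%:E); rewrite /= -expr2.
have rc : \rank (c s (cover_chart k) (pt k z)) = m.
  apply: one_form_inj_rank; last by apply: dom_pt; apply/set_mem.
  apply: cinj; apply: subdivision_itv t0 tN smooth _ _ (ltn_ord j) _.
  by have /set_mem := sI; rewrite /= in_itv.
by rewrite speedE// sqr_sqrtr// matrix_metric_ge0.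
Qed.

(** The L2 norm of the lengths of the paths of matrices traced at the points
    of [M] is at most the length of the path of one-forms. *)
Lemma integral_point_length_le :
  (\sum_(k < K) \int[lebesgue_measure_tuple R m]_(z in piece_rows k)
     point_length c N t v (cover_chart k)
       (chart_param (cover_chart k) (row_of_tuple z)) ^+ 2 <=
   (\sum_(j < N) \int[lebesgue_measure]_(s in `[t j, t j.+1])
      sqrte (ebin_metric (c s) (v j s) (v j s))) ^+ 2)%E.
Proof.
set mu := lebesgue_measure_tuple R m.
rewrite (_ : (\sum_(k < K) _)%E =
    inner mu (total lebesgue_measure f) (total lebesgue_measure f)); last first.
  apply: eq_bigr => k _; rewrite [LHS]integral_mkcond.
  apply: eq_integral => z _.
  by rewrite total_f !patchE; case: ifP => // _; rewrite mul0e.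
rewrite (_ : (\sum_(j < N) _)%E =
    (\sum_(j < N) \int[lebesgue_measure]_s l2 mu (slice f j s))%E); last first.
  apply: eq_bigr => j _; rewrite [LHS]integral_mkcond.
  by congr (integral _ _ _); apply/funext => s; rewrite l2_slice.
exact: minkowski_integral mf f0.
Qed.

End lengths_of_paths_of_forms.

(** * Lower bounds of the geodesic distance *)

Section lower_bounds.
Context (R : realType) (m n : nat) (M : compact_manifold R m).
Local Notation form := (chart M -> M -> 'M[R]_(n, m)).
Local Notation K := (size (chart_cover M)).
Implicit Types (al be : form) (i : chart M) (x : M).

Lemma geodesic_dist_ge0 (E : lmodType R) (W : set E) (I : Type)
    (B : I -> R -> set E) (P : set E) (g : E -> E -> E -> \bar R) (p q : E) :
  (0 <= geodesic_dist W B P g p q)%E.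
Proof.
apply/ereal_infP => _ [c [N [t [v [_ _ _ _ ->]]]]].
by apply: sume_ge0 => k _; apply: integral_ge0 => s _; apply: sqrte_ge0.
Qed.

(** It suffices to bound the length of the path traced at each point, for
    every path of one-forms. *)
Lemma le_ebin_dist_sqr al be
    (h : 'I_K -> m.-tuple (measurableTypeR R) -> \bar R) :
  (forall k z, piece_rows k z -> 0 <= h k z)%E ->
  (forall (c : R -> form) (N : nat) (t : nat -> R) (v : nat -> R -> form),
     c 0 = al -> c 1 = be ->
     (forall s, 0 <= s <= 1 -> one_form_inj (c s)) ->
     t 0%N = 0 -> t N = 1 ->
     (forall j, (j < N)%N -> t j < t j.+1 /\
       smooth_curve (@one_form R m n M) (@form_ball R m n M) (t j) (t j.+1)
         c (v j)) ->
     forall k z, piece_rows k z ->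
       (h k z <= point_length c N t v (cover_chart k)
         (chart_param (cover_chart k) (row_of_tuple z)) ^+ 2)%E) ->
  (\sum_(k < K) \int[lebesgue_measure_tuple R m]_(z in piece_rows k) h k z <=
    ebin_dist al be ^+ 2)%E.
Proof.
move=> h0 hle; set I := (\sum_(k < K) _)%E.
have I0 : (0 <= I)%E by apply: sume_ge0 => k _; apply: integral_ge0; apply: h0.
suff : (sqrte I <= ebin_dist al be)%E.
  move=> H; rewrite -(sqr_sqrte I0) !expe2; apply: lee_pmul => //; exact: sqrte_ge0.
apply/ereal_infP => _ [c [N [t [v [[c0 c1] cinj [t0 tN] smooth ->]]]]].
set L := (\sum_(j < N) _)%E.
have L0 : (0 <= L)%E.
  by apply: sume_ge0 => k _; apply: integral_ge0 => s _; apply: sqrte_ge0.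
rewrite -[leRHS]gee0_abs// -sqrte_sqr lee_sqrt ?expe_ge0//.
apply: le_trans (integral_point_length_le cinj t0 tN smooth).
apply: lee_sum => k _; apply: ge0_le_integral_any => z kz; first exact: h0.
exact: hle kz.
Qed.

Lemma unit_basisP (mu : chart M -> M -> R) i x : (0 < m)%N -> mu i x != 0 ->
  mu i x * \det (unit_basis mu i x) = 1.
Proof.
move=> m0 mu0; apply: (xgetPex 0
  (P := [set b : 'M[R]_m | mu i x * \det b = 1])).
exists (diag_mx (\row_b if b == Ordinal m0 then (mu i x)^-1 else 1)) => /=.
rewrite det_diag (bigD1 (Ordinal m0))//= mxE eqxx big1 ?mulr1 ?divff//.
by move=> b /negPf b0; rewrite mxE b0.
Qed.

(** In a basis of unit volume, [|det b|] is the inverse of [|mu i x|]. For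
    [m = 0] such a basis may not exist, but then there is a single matrix and
    the distance vanishes. *)
Lemma pointwise_dist_le (mu : chart M -> M -> R) (al be : form) i x
    (l : \bar R) : (0 <= l)%E -> mu i x != 0 ->
  (m = 0%N -> l = 0%E) ->
  (forall b : 'M[R]_m, b \in unitmx ->
    (matrix_dist (al i x *m b) (be i x *m b) <= (Num.sqrt `|\det b|)%:E * l)%E) ->
  (pointwise_dist mu al be i x ^+ 2 * `|mu i x|%:E <= l ^+ 2)%E.
Proof.
move=> l0 mu0 lm H; set b := unit_basis mu i x.
have d0 : (0 <= pointwise_dist mu al be i x)%E by apply: geodesic_dist_ge0.
have [m0|m0] := posnP m.
  have : (pointwise_dist mu al be i x <= 0)%E.
    rewrite /pointwise_dist -/b -(mule0 (Num.sqrt `|\det b|)%:E) -(lm m0).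
    apply: H; rewrite unitmxE; move: b; rewrite m0 => b.
    by rewrite det_mx00 unitr1.
  move=> d1; have -> : pointwise_dist mu al be i x = 0%E.
    by apply/eqP; rewrite eq_le d1.
  by rewrite expe2 !mul0e expe_ge0.
have mub := unit_basisP m0 mu0; rewrite -/b in mub.
have ub : b \in unitmx.
  rewrite unitmxE unitfE; apply/eqP => b0; move: mub; rewrite b0 mulr0.
  by move/esym/eqP; rewrite oner_eq0.
have dle := H b ub.
apply: (@le_trans _ _ (((Num.sqrt `|\det b|)%:E * l) ^+ 2 * `|mu i x|%:E)%E).
  by apply: lee_wpmul2r => //; rewrite !expe2; apply: lee_pmul.
rewrite !expe2 muleACA -EFinM -expr2 sqr_sqrtr// muleAC -EFinM -normrM mulrC.
by rewrite mub normr1 mul1e.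
Qed.

End lower_bounds.

(** * Non-degeneracy *)

Section separation.
Context (R : realType) (m n : nat) (M : compact_manifold R m).
Local Notation form := (chart M -> M -> 'M[R]_(n, m)).
Local Notation K := (size (chart_cover M)).
Implicit Types (al be : form) (i : chart M) (x : M).

Lemma one_form_neq_cover al be : one_form al -> one_form be -> al <> be ->
  exists k : 'I_K, exists2 x, chart_dom (cover_chart k) x &
    al (cover_chart k) x <> be (cover_chart k) x.
Proof.
move=> fal fbe albe; apply: contrapT => H; apply: albe.
apply/funext => i; apply/funext => x.
have [ix|ix] := pselect (chart_dom i x); last first.
  by rewrite (one_form_out fal ix) (one_form_out fbe ix).
have [k kx] := projT2 (cid (finite_chart_cover M)) x.
rewrite (one_form_change fal ix kx) (one_form_change fbe ix kx).
congr (_ *m _); apply: contrapT => ne; apply: H.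
by exists k, x.
Qed.

(** In the first chart of the cover that meets the open set where the two forms
    differ, the part of this set in the chart avoids all earlier charts. This
    gives an open subset of a piece; a piece itself may have empty interior. *)
Lemma one_form_neq_piece al be : one_form al -> one_form be -> al <> be ->
  exists k : 'I_K,
    (exists2 x, chart_dom (cover_chart k) x &
       al (cover_chart k) x <> be (cover_chart k) x) /\
    (forall x, chart_dom (cover_chart k) x ->
       al (cover_chart k) x <> be (cover_chart k) x -> piece (M := M) k x).
Proof.
move=> fal fbe /(one_form_neq_cover fal fbe)[k0 k0P].
pose P (k : 'I_K) := `[< exists2 x, chart_dom (cover_chart k) x &
    al (cover_chart k) x <> be (cover_chart k) x >].
have Pk0 : P k0 by apply/asboolP.
case: (arg_minnP (fun k : 'I_K => k : nat) Pk0) => k /asboolP Pk kmin.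
exists k; split=> // x kx ne; split=> // -[l /= lk lx].
suff /kmin : P l by rewrite leqNgt lk.
apply/asboolP; exists x => // eq; apply: ne.
by rewrite (one_form_change fal kx lx) (one_form_change fbe kx lx) eq.
Qed.

Definition box (y : 'rV[R]_m) (e : R) : set (m.-tuple (measurableTypeR R)) :=
  [set z | forall b, y 0 b < tnth z b < y 0 b + e].

Lemma measurable_box y e : measurable (box y e).
Proof.
have -> : box y e = @row_of_tuple R m @^-1`
    [set y' | forall b, `]y 0 b, y 0 b + e[%classic (y' 0 b)].
  by apply/seteqP; split=> z /= zA b; have := zA b; rewrite /= mxE in_itv.
apply: (measurable_row_box (A := fun b => `]y 0 b, y 0 b + e[%classic)) => b.
exact: measurable_itv.
Qed.

(** Every neighbourhood of a point of the half-space contains a box in the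
    half-space with a corner at the point. *)
Lemma nbhs_half_space_box (y : 'rV[R]_m) (P : set 'rV[R]_m) :
  half_space y -> (\forall y' \near y, half_space y' -> P y') ->
  exists2 e, 0 < e & forall z, box y e z -> P (row_of_tuple z).
Proof.
move=> hy /nbhs_ballP[e /= e0 eP]; exists e => // z zbox; apply: eP.
  split=> // a b; rewrite ord1 /ball /= mxE distrC ltr_distlC.
  by have /andP[z1 z2] := zbox b; apply/andP; split=> //; lra.
move=> b b0; rewrite mxE; have /andP[+ _] := zbox b.
by move/ltW; apply: le_trans; apply: hy.
Qed.

(** A separating function differs by more than [de] on a box of positive measure
    inside a piece, so that every path has length at least [de] divided by the
    Lipschitz constant at each point of the box. *)
Lemma ebin_dist_gt0 al be : one_form_inj al -> one_form_inj be -> al <> be ->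
  (0 < ebin_dist al be)%E.
Proof.
move=> ial ibe albe.
have [k [[x kx ne] kpiece]] := one_form_neq_piece ial.1 ibe.1 albe.
pose i := cover_chart k.
have [p xp] : exists p, sep p (al i x) <> sep p (be i x).
  apply: contrapT => H; apply: ne.
  apply: sep_inj; [exact: one_form_inj_rank|exact: one_form_inj_rank|].
  by move=> p; apply: contrapT => ?; apply: H; exists p.
pose D y := `|sep p (be i (chart_param i y)) - sep p (al i (chart_param i y))|.
pose y := chart_coord i x.
have iy : coord_image i y by exists x.
pose de := D y / 2.
have de0 : 0 < de.
  rewrite divr_gt0// /D /y chart_paramK// normr_gt0 subr_eq0.
  by apply/eqP => /esym.
have cD : D y' @[y' --> within (coord_image i) (nbhs y)] --> D y.
  have csep z : one_form_inj z -> sep p (z i (chart_param i y'))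
      @[y' --> within (coord_image i) (nbhs y)] --> sep p (z i (chart_param i y)).
    move=> iz; apply: cvg_sep => a b.
    have cz := @form_continuous_in_chart _ _ _ M i a b z iz.1.
    exact: (subspace_continuousP _ _).1 cz y iy.
  by apply: cvg_norm; apply: cvgB; apply: csep.
have [U oU VU] := @chart_coord_open _ _ M i.
have [Uy hy] : (U `&` @half_space R m) y by rewrite -VU.
have : \forall y' \near y, half_space y' -> coord_image i y' /\ de < D y'.
  have : \forall y' \near within (coord_image i) (nbhs y), de < D y'.
    apply: (cvgr_gt _ cD); rewrite /de ltr_pdivrMr// ltr_pMr// ?ltr1n//.
    by move: de0; rewrite /de; lra.
  rewrite near_withinE => near_de.
  have near_U : \forall y' \near y, U y' by apply: open_nbhs_nbhs.
  near=> y' => hy'.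
  have iy' : coord_image i y'.
    by rewrite /coord_image VU; split=> //; near: y'.
  by split=> //; move: iy'; near: y'.
move=> /(nbhs_half_space_box hy)[e e0 eP].
have box_piece : box y e `<=` piece_rows k.
  move=> z /eP[iz dz]; have [iz1 iz2] := coord_imageP iz.
  exists (chart_param i (row_of_tuple z)) => //; apply: kpiece => // eqz.
  by move: dz; rewrite /D -/i eqz subrr normr0 ltNge (ltW de0).
pose C := sep_bound R n.
have C0 : 0 < C by rewrite /C /sep_bound ltr_wpDl// mulr_ge0.
pose h (k' : 'I_K) z : \bar R :=
  if k' == k then ((cst ((de / C) ^+ 2)%:E) \_ (box y e)) z else 0%E.
have h0 k' z : (0 <= h k' z)%E.
  rewrite /h; case: ifP => // _; rewrite patchE; case: ifP => // _.
  by rewrite lee_fin sqr_ge0.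
suff : (0 < ebin_dist al be ^+ 2)%E.
  have : (0 <= ebin_dist al be)%E by apply: geodesic_dist_ge0.
  by rewrite le_eqVlt => /predU1P[<-|//]; rewrite expe2 mul0e ltxx.
apply: (@lt_le_trans _ _ (\sum_(k' < K)
    \int[lebesgue_measure_tuple R m]_(z in piece_rows k') h k' z)%E).
  rewrite (bigD1 k)//=; apply: (@lt_le_trans _ _
      (\int[lebesgue_measure_tuple R m]_(z in piece_rows k) h k z)%E).
    rewrite /h eqxx -integral_mkcondr integral_cst; last first.
      by rewrite setIidr//; exact: measurable_box.
    rewrite setIidr//; apply: mule_gt0.
      by rewrite lte_fin exprn_gt0// divr_gt0.
    exact: (lebesgue_measure_box_gt0 (fun b => y 0 b)).
  by rewrite leeDl//; apply: sume_ge0 => k' _; apply: integral_ge0.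
apply: le_ebin_dist_sqr => // c N t v c0 c1 cinj t0 tN smooth k' z kz.
rewrite /h; case: eqP => [k'k|_]; last by rewrite expe_ge0// point_length_ge0.
subst k'; rewrite patchE; case: ifPn => [/set_mem zbox|_]; last first.
  by rewrite expe_ge0// point_length_ge0.
have [iz /ltW dz] := eP z zbox; have [iz1 _] := coord_imageP iz.
rewrite /= EFin_expe !expe2.
have le1 : ((de / C)%:E <=
    point_length c N t v i (chart_param i (row_of_tuple z)))%E.
  rewrite mulrC EFinM lee_pdivrMl//.
  apply: le_trans (sep_le_point_length cinj t0 tN smooth p iz1).
  by rewrite c0 c1 lee_fin.
have q0 : (0 <= (de / C)%:E)%E by rewrite lee_fin divr_ge0// ltW.
exact: lee_pmul.
Unshelve. all: by end_near. Qed.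

End separation.

Theorem theorem4p5 (R : realType) (m n : nat) (hmn : (m <= n)%N)
    (M : compact_manifold R m)
    (mu : chart M -> M -> R) (hmu : volume_form mu) :
  (forall al be : chart M -> M -> 'M[R]_(n, m),
     one_form_inj al -> one_form_inj be -> al <> be ->
     (0 < ebin_dist al be)%E) /\
  (forall al be : chart M -> M -> 'M[R]_(n, m),
     one_form_inj al -> one_form_inj be ->
     (integral_volume mu (fun i x => pointwise_dist mu al be i x ^+ 2)
        <= ebin_dist al be ^+ 2)%E).
Proof.
split=> [al be|al be ial ibe]; first exact: ebin_dist_gt0.
apply: (le_ebin_dist_sqr (h := fun k z => (pointwise_dist mu al be (cover_chart k)
    (chart_param (cover_chart k) (row_of_tuple z)) ^+ 2 *
    `|mu (cover_chart k) (chart_param (cover_chart k) (row_of_tuple z))|%:E)%E)).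
  by move=> k z _; rewrite mule_ge0 ?lee_fin// expe_ge0// geodesic_dist_ge0.
move=> c N t v c0 c1 cinj t0 tN smooth k z kz.
have [kx _] := coord_imageP (piece_rows_image kz).
apply: pointwise_dist_le.
- exact: point_length_ge0.
- exact: volume_form_neq0 hmu _ _ kx.
- move=> m0; rewrite /point_length big1// => j _; apply: integral0_eq => s _.
  rewrite /speed; set u := v _ _ _ _; set a := c _ _ _.
  have -> : u *m pinv a = 0.
    apply/matrixP => p q; rewrite !mxE big1// => r.
    by exfalso; move: (ltn_ord r); rewrite [X in (_ < X)%N]m0.
  rewrite /norm2 big1 ?sqrtr0 ?mul0r// => p _; rewrite big1// => q _.
  by rewrite mxE expr0n.
move=> b ub; have := matrix_dist_le_point_length cinj t0 tN smooth kx ub.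
by rewrite c0 c1.
Qed.
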